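(* Consider a branching random walk in an i.i.d. time-inhomogeneous random environment $\xi=(F_k)_{k\in\mathbb{Z}}$ with jump law $\mu$, satisfying assumptions (i) and (ii) of the context. Assume $\alpha>1$ (which implies $\Lambda_e(1)<0$), let $\lambda_1$ be the unique positive solution of $\Lambda_e(1)+\Lambda_s(\lambda_1)=0$, and assume $$\varTheta(1):=\Lambda_e'(1)+\Lambda_s(\lambda_1)-\lambda_1\Lambda_s'(\lambda_1)<0 .$$ Assume in addition that $$\mathbb{E}\left(e^{X_1-\Lambda_e(1)}\log_+\eta_1\right)<\infty,\qquad \log_+x=\log(\max\{x,1\}).$$ Then there exists a constant $C_1\in(0,1]$ such that, as $x\to\infty$ along the positive integers, $$\lim_{x\to\infty}e^{\lambda_1x}\,\mathbb{P}(M\ge x)=C_1 .$$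
   Context: Let $\mathbb{N}_0=\{0,1,2,\dots\}$ and let $\mathcal{P}(\mathbb{N}_0)$ be the space of probability measures on $\mathbb{N}_0$ with the total variation metric. For $F\in\mathcal{P}(\mathbb{N}_0)$ put $\overline F=\sum_{k\ge0}kF[k]$ and $\tilde F=\overline F^{-2}\sum_{k\ge1}k(k-1)F[k]$. The environment $\xi=(F_k)_{k\in\mathbb{Z}}$ is, under the probability $P_E$, an i.i.d. sequence of random elements of $\mathcal{P}(\mathbb{N}_0)$. Put $X_k=\log\overline{F}_k$ and $\eta_k=\tilde F_k$. Given $\xi$, the quenched law $P_\xi$ is that of the following branching random walk: there is one particle at position $0$ in generation $0$; for $k\ge1$ each particle of generation $k-1$ independently has a number of children with law $F_k$; each child's position is its parent's position plus an independent displacement with law $\mu$. $M$ is the supremum of the positions of all particles over all generations. The annealed law is $\mathbb{P}(\cdot)=\int P_\xi(\cdot)\,P_E(d\xi)$, with expectation $\mathbb{E}$. Assumptions: (i) $a:=\mathbb{E}[X_1]\in(-\infty,0)$ and $\Lambda_e(\rho):=\log\mathbb{E}[e^{\rho X_1}]<\infty$ for all $\rho\ge0$. (ii) $\mu$ is a probability measure supported on $\mathbb{Z}$, non-trivial (not a point mass), with $\mu([2,\infty))=0$ and mean $0$. Put $\Lambda_s(\lambda):=\log\int e^{\lambda y}\mu(dy)<\infty$ for $\lambda>0$; for every $\delta>0$ the equation $\Lambda_s(\lambda)=\delta$ has a unique solution in $(0,\infty)$. Put $\alpha:=\sup\{\rho:\Lambda_e(\rho)\le0\}\in(0,\infty]$.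 *)

(* Defs.v *)
From HB Require Import structures.
From mathcomp Require Import all_boot all_order all_algebra.
From mathcomp Require Import all_classical all_reals all_analysis.
Set Implicit Arguments.
Unset Strict Implicit.
Unset Printing Implicit Defensive.
Import Order.TTheory GRing.Theory Num.Theory.
Import numFieldNormedType.Exports.
Local Open Scope classical_set_scope.
Local Open Scope ring_scope.

Section Independence.
Context d (T : measurableType d) (R : realType).
Implicit Types P : {measure set T -> \bar R}.

(* G assigns a sub-sigma-algebra to each index; J ranges over the finite sets
   of indices. *)
Definition independent_families P (I : eqType) (G : I -> set (set T)) : Prop :=
  forall (J : seq I) (A : I -> set T),
    uniq J -> (forall i, i \in J -> G i (A i)) ->
    (P (\big[setI/setT]_(i <- J) A i) = \prod_(i <- J) P (A i))%E.

Definition generated d' (T' : measurableType d') (X : T -> T') : set (set T) :=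
  preimage_set_system setT X measurable.

End Independence.

(* The space of laws on the nonnegative integers carries the Borel
   sigma-algebra of the total variation metric. *)
Section Laws.
Context (R : realType).
Implicit Types F G : probability nat R.

Definition tv_dist F G : R :=
  sup [set `|fine (F A) - fine (G A)| | A in [set: set nat]].

Definition tv_open (U : set (probability nat R)) : Prop :=
  forall F, U F ->
    exists2 eps : R, 0 < eps & forall G, tv_dist F G < eps -> U G.

Definition law : Type := g_sigma_algebraType tv_open.
HB.instance Definition _ := Measurable.on law.

Local Open Scope ereal_scope.

Definition mean F : \bar R := \sum_(0 <= k <oo) k%:R%:E * F [set k].

(* The value of the inverse at mean 0 or +oo is a junk value; these cases have
   probability 0 as soon as the logarithm of the mean is integrable. *)
Definition normalized_second_factorial_moment F : \bar R :=
  (mean F ^+ 2)^-1 * \sum_(1 <= k <oo) (k * k.-1)%:R%:E * F [set k].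

End Laws.

Section Environment.
Context d (E : measurableType d) (R : realType).
Variables (PE : probability E R) (F : int -> E -> law R).

Definition iid_environment : Prop :=
  [/\ forall k, measurable_fun setT (F k),
      independent_families PE (fun k => generated (F k)) &
      forall k (B : set (law R)), measurable B ->
        PE (F k @^-1` B) = PE (F 0 @^-1` B)].

Local Open Scope ereal_scope.

Definition env_X (k : int) (e : E) : \bar R := lne (mean (F k e)).

Definition env_eta (k : int) (e : E) : \bar R :=
  normalized_second_factorial_moment (F k e).

Definition Lambda_e (rho : R) : \bar R :=
  lne (\int[PE]_e expeR (rho%:E * env_X 1 e)).

Definition alpha : \bar R :=
  ereal_sup [set rho%:E | rho in [set rho | Lambda_e rho <= 0]].

End Environment.

Definition Lambda_s (R : realType) (mu : probability (measurableTypeR R) R)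
    (lambda : R) : \bar R :=
  lne (\int[mu]_y (expR (lambda * y))%:E)%E.

Definition log_plus (R : realType) (x : \bar R) : \bar R := lne (maxe x 1%E).

(* Particles carry Ulam-Harris labels in reverse order: [::] is the initial
   particle, i :: u is the i-th child (counting from 0) of u, and size u is
   the generation of u.  [n u] is the number of children of u and [d u] the
   displacement of u from its parent; [d [::]] and the values at labels that are
   not alive are not used. *)
Section Tree.
Context (R : realType).
Variables (n : seq nat -> nat) (d : seq nat -> R).

Fixpoint alive (u : seq nat) : bool :=
  if u is i :: v then alive v && (i < n v)%N else true.

Fixpoint position (u : seq nat) : R :=
  if u is _ :: v then position v + d u else 0.

Definition maximum : \bar R :=
  ereal_sup [set (position u)%:E | u in [set u | alive u]].

End Tree.

(* Under P the numbers of children N and the displacements D are mutually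
   independent, N u has the law F_k with k = size u + 1 and D u has law mu. *)
Section BRW.
Context d (Omega : measurableType d) (R : realType).

Definition is_quenched_law (mu : probability (measurableTypeR R) R)
    (F : int -> law R) (P : {measure set Omega -> \bar R})
    (N : seq nat -> Omega -> nat)
    (D : seq nat -> Omega -> measurableTypeR R) : Prop :=
  [/\ forall u B, P (N u @^-1` B) = (F (size u).+1%:Z : probability nat R) B,
      forall u B, measurable B -> P (D u @^-1` B) = mu B &
      independent_families P (fun i : seq nat + seq nat =>
        match i with
        | inl u => generated (N u)
        | inr u => generated (D u)
        end)].

Definition annealed d' (E : measurableType d') (PE : probability E R)
    (Pxi : R.-pker E ~> Omega) (A : set Omega) : \bar R :=
  (\int[PE]_e Pxi e A)%E.

End BRW.

Section Assumptions.
Context (R : realType).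
Local Open Scope ereal_scope.

Definition assumption_i d (E : measurableType d) (PE : probability E R)
    (F : int -> E -> law R) : Prop :=
  [/\ PE.-integrable setT (env_X F 1),
      \int[PE]_e env_X F 1 e < 0 &
      forall rho : R, (0 <= rho)%R -> Lambda_e PE F rho < +oo].

Definition assumption_ii (mu : probability (measurableTypeR R) R) : Prop :=
  [/\ mu (range (fun z : int => z%:~R : R)) = 1,
      forall y : R, mu [set y] != 1,
      mu `[2%R, +oo[%classic = 0,
      mu.-integrable setT (EFin : measurableTypeR R -> \bar R) /\
        \int[mu]_y y%:E = 0 &
      (forall lambda : R, (0 < lambda)%R -> Lambda_s mu lambda < +oo) /\
      (forall delta : R, (0 < delta)%R ->
         exists! lambda : R, (0 < lambda)%R /\ Lambda_s mu lambda = delta%:E)].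

End Assumptions.

(* Main.v *)
Require Import Defs.
From HB Require Import structures.
From mathcomp Require Import all_boot all_order all_algebra.
From mathcomp Require Import all_classical all_reals all_analysis.
From mathcomp Require Import measurable_realfun ring lra.
Set Implicit Arguments.
Unset Strict Implicit.
Unset Printing Implicit Defensive.
Import Order.TTheory GRing.Theory Num.Theory.
Import numFieldNormedType.Exports.
Local Open Scope classical_set_scope.
Local Open Scope ring_scope.

(** The walk climbs by at most one level per generation, so a line of descent
    that reaches a level at or above [x] passes through [x] itself.  By the
    many-to-one identity and the relation between the two exponents, the
    expected number of particles that first hit level [z] is
    [expR (- lambda1 * z)], and each of them starts a fresh copy of the process
    in a fresh environment.  A union bound over these particles
    ([annealed_hit_decay]) shows that [expR (lambda1 * x) * P (M >= x)] is at
    most 1 and nonincreasing in [x].  Hence the limit exists, and the substance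
    of the theorem is that it is positive.

    For positivity, let [p n z] be the quenched probability that distance [z] is
    climbed within [n] generations.  Independence of the subtrees of distinct
    children ([reach_prob]) gives an exact recursion: [p n.+1 z.+1] is
    [survival F s], where [F] is the first offspring law, [s] is the mean of
    [p n (z + j)] over a jump [1 - j] and in the environment shifted by one,
    and [survival F s] is one minus the generating function of [F] at [1 - s].
    The linear part [mean F * s] of [survival] would give exactly
    [expR (- lambda1 * z)] for the annealed probabilities, so only the error of
    the linearization has to be controlled.  With [m = mean F], [eta] the
    normalized second factorial moment and [0 < th <= 1], the error is at most
    [L `^ th * (m * s) `^ (1 + th)] if [eta <= L], and at most [m * s] otherwise
    ([mean_le_survival_trunc]).

    - The first part is governed by the annealed moments of order [1 + th] of
      [p n z].  Hölder's inequality along the walk tilted by [lambda1] bounds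
      them by a multiple of [expR (- (lambda1 + del * th) * z)], with some
      [del > 0], as soon as [th] is small: the first-order condition at [th = 0]
      is the negativity of the derivative expression in the hypotheses
      ([choose_exponents], [moment_hit_decay]).  There is room to let
      [L = expR (del / 2 * z)] grow with [z].
    - The second part costs [E (m; eta > L)] relative to the main term.  For this
      exponentially growing [L] the sum of these costs over [z] is controlled by
      [E (m * log eta)] ([trunc_mean_sum]).

    So the errors relative to [expR (- lambda1 * z)] are dominated by a
    nonincreasing summable sequence.  Two parameters make its sum small: a shift
    of the truncation level, and the replacement of the boundary value 1 by a
    small [eps], which scales the main term by [eps] but the first error by
    [eps `^ (1 + th)].  The tilted walk has positive drift ([mgf_drift]), and for
    such a walk the tail sums of the errors form a convex barrier that absorbs
    all of them ([barrier_lower]).  This bounds the annealed probabilities below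
    by [eps / 2 * expR (- lambda1 * z)]. *)

(** * Generating functions of offspring laws *)

Lemma one_sub_pow_itv (R : realType) (s : R) (k : nat) : 0 <= s <= 1 ->
  0 <= 1 - (1 - s) ^+ k <= 1.
Proof.
move=> /andP[s0 s1]; rewrite subr_ge0 gerBl exprn_ge0 ?subr_ge0// andbT.
by rewrite exprn_ile1 ?subr_ge0// gerBl.
Qed.

Lemma one_sub_pow_le (R : realType) (s : R) (k : nat) : 0 <= s <= 1 ->
  1 - (1 - s) ^+ k <= k%:R * s.
Proof.
move=> s01; elim: k => [|k IH]; first by rewrite expr0 subrr mul0r.
have /andP[p0 p1] := one_sub_pow_itv k s01.
rewrite exprS -natr1; case/andP: s01 => s0 s1; nra.
Qed.

Lemma bonferroni (R : realType) (s : R) (k : nat) : 0 <= s <= 1 ->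
  k%:R * s <= 1 - (1 - s) ^+ k + (k * k.-1)%:R * s ^+ 2.
Proof.
move=> s01; elim: k => [|k IH]; first by rewrite expr0 subrr !mul0r addr0.
have H := one_sub_pow_le k s01.
have /andP[p0 p1] := one_sub_pow_itv k s01.
have -> : (k.+1 * k.+1.-1)%:R = (k * k.-1)%:R + 2 * k%:R :> R.
  by case: k {IH H p0 p1} => [|k] /=; rewrite ?mul0n ?mulr0 ?addr0// !natrM -!natr1; ring.
have k0 : 0 <= k%:R :> R by [].
rewrite exprS -natr1; case/andP: s01 => s0 s1; nra.
Qed.

Section survival_function.
Context (R : realType).
Implicit Types (F G : probability nat R) (s t : R).
Local Open Scope ereal_scope.

Lemma sum_atoms F : \sum_(k <oo) F [set k] = 1.
Proof.
rewrite -(@probability_setT _ _ _ F) -(@measure_semi_bigcup _ _ _ F)//.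
- by congr (F _); rewrite -subTset => k _; exists k.
- by move=> i j _ _ [x [-> ->]].
Qed.

(** One minus the generating function at [1 - s]: the probability that at
    least one child survives, when each survives with probability [s]. *)
Definition survival F s : R :=
  fine (\sum_(k <oo) (1 - (1 - s) ^+ k)%:E * F [set k]).

Lemma survivalE F s : (0 <= s <= 1)%R ->
  (survival F s)%:E = \sum_(k <oo) (1 - (1 - s) ^+ k)%:E * F [set k].
Proof.
move=> s01.
have p01 k := one_sub_pow_itv k s01.
rewrite /survival fineK// ge0_fin_numE; last first.
  by apply: nneseries_ge0 => k _ _; rewrite mule_ge0// lee_fin; case/andP: (p01 k).
apply: (@le_lt_trans _ _ 1); last exact: ltry.
rewrite -(sum_atoms F); apply: lee_nneseries => k //.
  by move=> *; rewrite mule_ge0// lee_fin; case/andP: (p01 k).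
by move=> _; rewrite gee_pMl// ?lee_fin//; case/andP: (p01 k).
Qed.

Lemma survival_ge0 F s : (0 <= s <= 1)%R -> (0 <= survival F s)%R.
Proof.
move=> s01; rewrite -lee_fin survivalE//.
by apply: nneseries_ge0 => k _ _; rewrite mule_ge0// lee_fin; case/andP: (one_sub_pow_itv k s01).
Qed.

Lemma le_survival F s t : (0 <= s)%R -> (s <= t)%R -> (t <= 1)%R ->
  (survival F s <= survival F t)%R.
Proof.
move=> s0 st t1.
have s01 : (0 <= s <= 1)%R by rewrite s0 (le_trans st).
have t01 : (0 <= t <= 1)%R by rewrite t1 (le_trans s0).
rewrite -lee_fin !survivalE//; apply: lee_nneseries => k.
  by move=> *; rewrite mule_ge0// lee_fin; case/andP: (one_sub_pow_itv k s01).
move=> _; rewrite lee_wpmul2r// lee_fin lerD2l lerN2 lerXn2r ?nnegrE ?subr_ge0//.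
  by case/andP: s01.
by rewrite lerD2l lerN2.
Qed.

Lemma survival_le1 F s : (0 <= s <= 1)%R -> (survival F s <= 1)%R.
Proof.
move=> s01; rewrite -lee_fin survivalE// -(sum_atoms F).
apply: lee_nneseries => k.
  by move=> *; rewrite mule_ge0// lee_fin; case/andP: (one_sub_pow_itv k s01).
by move=> _; rewrite gee_pMl// ?lee_fin//; case/andP: (one_sub_pow_itv k s01).
Qed.

Lemma mean_ge0 F : 0 <= mean F.
Proof. by apply: nneseries_ge0 => k _ _; rewrite mule_ge0// lee_fin. Qed.

Lemma survival_le_mean F s : (0 <= s <= 1)%R ->
  (survival F s)%:E <= mean F * s%:E.
Proof.
move=> s01; rewrite survivalE// muleC -nneseriesZl; last first.
  by move=> k _; rewrite mule_ge0// lee_fin.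
apply: lee_nneseries => k.
  by move=> *; rewrite mule_ge0// lee_fin; case/andP: (one_sub_pow_itv k s01).
by move=> _; rewrite muleA lee_wpmul2r// -EFinM lee_fin mulrC one_sub_pow_le.
Qed.

(** Bonferroni's inequality summed over the number of children. *)
Lemma mean_le_survival F s : (0 <= s <= 1)%R ->
  mean F * s%:E <= (survival F s)%:E +
    (s ^+ 2)%:E * \sum_(1 <= k <oo) (k * k.-1)%:R%:E * F [set k].
Proof.
move=> s01; have p01 k := one_sub_pow_itv k s01.
have -> : \sum_(1 <= k <oo) (k * k.-1)%:R%:E * F [set k] =
  \sum_(k <oo) (k * k.-1)%:R%:E * F [set k].
  rewrite [RHS]nneseries_recl//=; first by rewrite mul0e add0e.
  by move=> k _; rewrite mule_ge0// lee_fin.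
rewrite survivalE// muleC -!nneseriesZl; do 1? by move=> k _; rewrite mule_ge0// lee_fin.
rewrite -nneseriesD; last 2 first.
- by move=> k _ _; rewrite mule_ge0// lee_fin; case/andP: (p01 k).
- by move=> k _ _; rewrite mule_ge0 ?mule_ge0// lee_fin ?sqr_ge0.
apply: lee_nneseries => k.
  by move=> *; rewrite mule_ge0 ?mule_ge0// lee_fin; case/andP: s01.
move=> _; rewrite !muleA -ge0_muleDl ?lee_fin; first last.
- by rewrite mulr_ge0// sqr_ge0.
- by case/andP: (p01 k).
by rewrite -!EFinM -EFinD lee_wpmul2r// lee_fin mulrC [(s ^+ 2 * _)%R]mulrC bonferroni.
Qed.

Definition second_factorial_moment F : \bar R :=
  \sum_(1 <= k <oo) (k * k.-1)%:R%:E * F [set k].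

(** Interpolation between the quadratic error of Bonferroni's inequality and
    the trivial bound [mean F * s].  The condition of the conditional says that
    the normalized second factorial moment is at most [L], with the inverse
    cleared.  On the right-hand side the second moment only occurs in this
    comparison, so that the expectation over the environment stays finite. *)
Lemma mean_le_survival_trunc F s (L th : R) : (0 <= s <= 1)%R -> (0 < L)%R ->
  (0 < th <= 1)%R ->
  mean F * s%:E <= (survival F s)%:E
    + (if second_factorial_moment F <= L%:E * (mean F * mean F) then 0 else mean F * s%:E)
    + (L `^ th)%:E * (poweR (mean F) (1 + th) * (s `^ (1 + th))%:E).
Proof.
move=> s01 L0 /andP[th0 th1].
have q0 : (0 < 1 + th)%R by rewrite addr_gt0.
have H3 : 0 <= (L `^ th)%:E * (poweR (mean F) (1 + th) * (s `^ (1 + th))%:E).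
  by rewrite !mule_ge0 ?poweR_ge0// ?lee_fin ?powR_ge0.
have sv0 : 0 <= (survival F s)%:E by rewrite lee_fin survival_ge0.
case: ifPn => [etaL|_]; last first.
  by rewrite addeAC leeDr// adde_ge0.
rewrite adde0.
have [s_eq0|s0] := eqVneq s 0%R; first by rewrite s_eq0 mule0 adde_ge0// -s_eq0.
have {}s0 : (0 < s)%R by rewrite lt_neqAle eq_sym s0; case/andP: s01.
have := mean_ge0 F.
case mF : (mean F) => [m| |]// m0; last first.
  have -> : (L `^ th)%:E * (poweR +oo (1 + th) * (s `^ (1 + th))%:E) = +oo.
    rewrite poweRyr ?gt_eqF// [X in _ * X]gt0_mulye ?lte_fin ?powR_gt0//.
    by rewrite gt0_muley// lte_fin powR_gt0.
  by rewrite addeC addye ?leey.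
have [m_eq0|mn0] := eqVneq m 0%R; first by rewrite m_eq0 mul0e adde_ge0// -m_eq0 -mF.
have {mn0}m_gt0 : (0 < m)%R by rewrite lt_neqAle eq_sym mn0 -lee_fin.
have ms0 : (0 < m * s)%R by exact: mulr_gt0.
have -> : ((L `^ th)%:E * (poweR m%:E (1 + th) * (s `^ (1 + th))%:E) =
    (m * s * (L * (m * s)) `^ th)%:E)%E.
  rewrite poweR_EFin -!EFinM -powRM ?ltW// powRD ?gt_eqF ?implybT//.
  by rewrite powRr1 ?ltW// (powRM _ (ltW L0) (ltW ms0)) mulrCA.
have [Lms|Lms] := leP (L * (m * s))%R 1%R; last first.
  apply: (le_trans _ (leeDr _ sv0)); rewrite -EFinM lee_fin; apply: ler_peMr; first exact: ltW.
  by rewrite -[leLHS](powRr0 (L * (m * s))) ler_powR// ltW.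
have := mean_le_survival F s01; rewrite mF => /le_trans; apply.
rewrite leeD2l//.
move: etaL; rewrite mF -!EFinM => etaL.
apply: (le_trans (lee_wpmul2l _ etaL)); first by rewrite lee_fin exprn_ge0// ltW.
rewrite -EFinM lee_fin.
have -> : (s ^+ 2 * (L * (m * m)) = m * s * (L * (m * s)))%R by ring.
apply: ler_wpM2l; first exact: ltW.
by apply: ger1_powR => //; rewrite mulr_gt0.
Qed.

End survival_function.

(** * Grouping of independent families *)

Section grouping.
Context d (T : measurableType d) (R : realType) (I : eqType).
Variables (P : {measure set T -> \bar R}) (G : I -> set (set T)).

(** Finite intersections of events of distinct members of the family, all with
    index in [S]: a pi-system that generates [joint S], and on which the product
    rule is the definition of independence. *)
Definition cylinder (S : set I) : set (set T) :=
  [set A | exists J B, [/\ uniq J, forall i, i \in J -> S i /\ G i (B i) &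
    A = \big[setI/setT]_(i <- J) B i]].

Definition joint (S : set I) : set (set T) := <<s cylinder S >>.

Hypothesis G_setI : forall i, setI_closed (G i).
Hypothesis G_meas : forall i, G i `<=` measurable.

Lemma in_bigI (J : seq I) (B : I -> set T) w :
  (\big[setI/setT]_(i <- J) B i) w <-> forall i, i \in J -> B i w.
Proof.
elim: J => [|j J IH]; first by rewrite big_nil.
rewrite big_cons; split => [[Bj /IH H] i|H].
  by rewrite inE => /orP[/eqP ->//|]; exact: H.
split; first by apply: H; rewrite inE eqxx.
by apply/IH => i iJ; apply: H; rewrite inE iJ orbT.
Qed.

Lemma cylinder_setT S : cylinder S setT.
Proof. by exists [::], (fun=> setT); split => //; rewrite big_nil. Qed.

Lemma sub_cylinder S i A : S i -> G i A -> cylinder S A.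
Proof.
move=> Si GA; exists [:: i], (fun=> A); split => //; last by rewrite big_seq1.
by move=> j; rewrite inE => /eqP ->.
Qed.

Lemma cylinder_setI S : setI_closed (cylinder S).
Proof.
move=> _ _ [J [A [_ JA ->]]] [K [B [_ KB ->]]].
exists (undup (J ++ K)), (fun i => if i \in J then if i \in K then A i `&` B i else A i else B i).
split; first exact: undup_uniq.
- move=> i; rewrite mem_undup mem_cat.
  have [iJ _|iJ /= iK] := boolP (i \in J); last exact: KB.
  have [iK|iK] := boolP (i \in K); last exact: JA.
  by split; [exact: (JA i iJ).1|apply: G_setI; [exact: (JA i iJ).2|exact: (KB i iK).2]].
- apply/seteqP; split => w.
    move=> [/in_bigI Aw /in_bigI Bw]; apply/in_bigI => i; rewrite mem_undup mem_cat.
    have [iJ _|iJ /= iK] := boolP (i \in J); last exact: Bw.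
    by have [iK|iK] := boolP (i \in K); [split; [exact: Aw|exact: Bw]|exact: Aw].
  move=> /in_bigI AB; split; apply/in_bigI => i iJ.
    by have := AB i; rewrite mem_undup mem_cat iJ => /(_ isT); case: ifP => // _ [].
  by have := AB i; rewrite mem_undup mem_cat iJ orbT => /(_ isT); case: ifP => // _ [].
Qed.

Lemma cylinder_measurable S : cylinder S `<=` measurable.
Proof.
move=> _ [J [B [_ JB ->]]]; rewrite big_seq_cond.
by apply: bigsetI_measurable => i /andP[/JB[_ /G_meas]].
Qed.

Lemma joint_measurable S : joint S `<=` measurable.
Proof.
apply: smallest_sub; last exact: cylinder_measurable.
exact: sigma_algebra_measurable.
Qed.

Lemma le_joint S S' A : joint S A -> S `<=` S' -> joint S' A.
Proof.
move=> + SS'; move: A; apply: sub_sigma_algebra2 => _ [J [B [uJ JB ->]]].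
by exists J, B; split => // i /JB[/SS'].
Qed.

Lemma joint_sub S i A : S i -> G i A -> joint S A.
Proof. by move=> Si GA; apply: sub_sigma_algebra; exact: sub_cylinder GA. Qed.

Lemma joint_setC S A : joint S A -> joint S (~` A).
Proof. by move=> SA; rewrite -setTD; apply: sigma_algebraCD. Qed.

Lemma joint_bigcup S (A : (set T)^nat) :
  (forall n, joint S (A n)) -> joint S (\bigcup_n A n).
Proof. exact: sigma_algebra_bigcup. Qed.

Lemma joint0 S : joint S set0. Proof. exact: sigma_algebra0. Qed.

Lemma jointT S : joint S setT.
Proof. by rewrite -setC0; apply: joint_setC; exact: joint0. Qed.

Lemma joint_setI S A B : joint S A -> joint S B -> joint S (A `&` B).
Proof.
move=> SA SB; rewrite -[A `&` B]setCK setCI; apply: joint_setC.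
rewrite -bigcup2E; apply: joint_bigcup => -[|[|n]] /=;
  [exact: joint_setC|exact: joint_setC|exact: joint0].
Qed.

Hypothesis PT : P setT = 1%E.
Hypothesis PG : independent_families P G.

Let fin_P A : measurable A -> P A \is a fin_num.
Proof.
move=> mA; rewrite ge0_fin_numE//; apply: (@le_lt_trans _ _ (P setT)).
  by apply: le_measure; rewrite ?inE//; exact: measurableT.
by rewrite PT ltry.
Qed.

Let product_rule_extend S B : measurable B ->
  (forall A, cylinder S A -> P (A `&` B) = (P A * P B)%E) ->
  forall A, joint S A -> P (A `&` B) = (P A * P B)%E.
Proof.
move=> mB PAB A SA.
have r0 : (0 <= fine (P B))%R by exact: fine_ge0.
pose m2 := mscale (NngNum r0) P.
have m2E X : m2 X = (P X * P B)%E.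
  by rewrite /m2 /mscale/= fineK ?fin_P// muleC.
rewrite -m2E -[LHS]/(mrestr P mB A).
apply: (g_sigma_algebra_measure_unique (cylinder S) _ (fun=> setT)) SA => //.
- exact: cylinder_measurable.
- by move=> _; exact: cylinder_setT.
- by rewrite bigcup_const//; exists 0%N.
- exact: cylinder_setI.
- by move=> C SC; rewrite [RHS]m2E -PAB.
- by move=> _; rewrite /= /mrestr setTI -ge0_fin_numE// fin_P.
Qed.

(** The pi-lambda theorem, applied once in each of the two arguments. *)
Lemma joint_independent S S' A B : (forall i, S i -> S' i -> False) ->
  joint S A -> joint S' B -> P (A `&` B) = (P A * P B)%E.
Proof.
move=> SS' SA S'B.
have key X Y : cylinder S X -> cylinder S' Y -> P (X `&` Y) = (P X * P Y)%E.
  move=> [J [C [uJ JC ->]]] [K [D [uK KD ->]]].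
  have nJK i : i \in J -> i \in K -> False.
    by move=> /JC[+ _] /KD[+ _]; exact: SS'.
  pose E i := if i \in J then C i else D i.
  have EJ : \big[setI/setT]_(i <- J) C i = \big[setI/setT]_(i <- J) E i.
    by apply: eq_big_seq => i iJ; rewrite /E iJ.
  have EK : \big[setI/setT]_(i <- K) D i = \big[setI/setT]_(i <- K) E i.
    by apply: eq_big_seq => i iK; rewrite /E; case: ifP => // iJ; case: (nJK i).
  have GE i : i \in J ++ K -> G i (E i).
    rewrite mem_cat /E; case: ifP => [/JC[]//|_ /= /KD[]//].
  have uJK : uniq (J ++ K).
    rewrite cat_uniq uJ uK andbT; apply/hasPn => i iK; apply/negP => iJ.
    exact: (nJK i).
  rewrite EJ EK -big_cat (PG uJK GE) big_cat/= (PG uJ) ?(PG uK)// => i iJ.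
    by apply: GE; rewrite mem_cat iJ orbT.
  by apply: GE; rewrite mem_cat iJ.
have mA := joint_measurable SA; have mB := joint_measurable S'B.
apply: (product_rule_extend mB) SA => X SX.
rewrite setIC muleC; apply: (product_rule_extend _ _ S'B).
  exact: cylinder_measurable SX.
by move=> Y S'Y; rewrite setIC muleC; exact: key.
Qed.

End grouping.

(** * The recursion for the hitting probabilities *)

Section recursion.
Context (R : realType).
Variable w : nat -> R.
Hypothesis w_ge0 : forall j, 0 <= w j.
Hypothesis w_le1 : (\sum_(j <oo) (w j)%:E <= 1)%E.

Definition step_avg (f : nat -> R) (z : nat) : R :=
  fine (\sum_(j <oo) (w j * f (z + j)%N)%:E)%E.

(** [z] is the distance that remains to be climbed; a jump [1 - j] takes [z.+1]
    to [z + j].  Reaching the target counts as a success with probability [eps]: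
    a small [eps] makes the recursion almost linear. *)
Fixpoint hit_prob (eps : R) (n : nat) (om : nat -> law R) (z : nat) : R :=
  if z is z'.+1 then
    if n is n'.+1 then
      survival (om 0%N : probability nat R)
        (step_avg (hit_prob eps n' (fun i => om i.+1)) z')
    else 0
  else eps.

Lemma step_avg_fin f z : (forall z, 0 <= f z <= 1) ->
  (\sum_(j <oo) (w j * f (z + j)%N)%:E)%E \is a fin_num.
Proof.
move=> f01; rewrite ge0_fin_numE; last first.
  by apply: nneseries_ge0 => j _ _; rewrite lee_fin mulr_ge0//; case/andP: (f01 (z + j)%N).
apply: le_lt_trans (ltry 1); apply: le_trans w_le1; apply: lee_nneseries => j.
  by move=> _ _; rewrite lee_fin mulr_ge0//; case/andP: (f01 (z + j)%N).
by move=> _; rewrite lee_fin ler_piMr//; case/andP: (f01 (z + j)%N).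
Qed.

Lemma step_avgE f z : (forall z, 0 <= f z <= 1) ->
  (step_avg f z)%:E = (\sum_(j <oo) (w j * f (z + j)%N)%:E)%E.
Proof. by move=> f01; rewrite /step_avg fineK// step_avg_fin. Qed.

Lemma step_avg_itv f z : (forall z, 0 <= f z <= 1) -> 0 <= step_avg f z <= 1.
Proof.
move=> f01; rewrite -!lee_fin step_avgE//; apply/andP; split.
  by apply: nneseries_ge0 => j _ _; rewrite lee_fin mulr_ge0//; case/andP: (f01 (z + j)%N).
apply: le_trans w_le1; apply: lee_nneseries => j.
  by move=> _ _; rewrite lee_fin mulr_ge0//; case/andP: (f01 (z + j)%N).
by move=> _; rewrite lee_fin ler_piMr//; case/andP: (f01 (z + j)%N).
Qed.

Lemma le_step_avg f g z : (forall z, 0 <= f z <= 1) -> (forall z, 0 <= g z <= 1) ->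
  (forall z, f z <= g z) -> step_avg f z <= step_avg g z.
Proof.
move=> f01 g01 fg; rewrite -lee_fin !step_avgE//; apply: lee_nneseries => j.
  by move=> _ _; rewrite lee_fin mulr_ge0//; case/andP: (f01 (z + j)%N).
by move=> _; rewrite lee_fin ler_wpM2l.
Qed.

Lemma hit_prob_itv eps n om z : 0 <= eps <= 1 -> 0 <= hit_prob eps n om z <= 1.
Proof.
move=> e01; elim: n om z => [|n IH] om [|z]//=; first by rewrite lexx ler01.
by rewrite survival_ge0 ?survival_le1// step_avg_itv.
Qed.

Lemma le_hit_prob_eps eps eps' n om z : 0 <= eps -> eps <= eps' -> eps' <= 1 ->
  hit_prob eps n om z <= hit_prob eps' n om z.
Proof.
move=> e0 ee e1.
have e01 : 0 <= eps <= 1 by rewrite e0 (le_trans ee).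
have e01' : 0 <= eps' <= 1 by rewrite e1 (le_trans e0).
elim: n om z => [|n IH] om [|z]//=.
have h z' := hit_prob_itv n (fun i => om i.+1) z' e01.
have h' z' := hit_prob_itv n (fun i => om i.+1) z' e01'.
apply: le_survival; [by case/andP: (step_avg_itv z h)|exact: le_step_avg|].
by case/andP: (step_avg_itv z h').
Qed.

Lemma le_hit_prob_time eps n om z : 0 <= eps <= 1 ->
  hit_prob eps n om z <= hit_prob eps n.+1 om z.
Proof.
move=> e01; elim: n om z => [|n IH] om [|z].
- by [].
- by case/andP: (hit_prob_itv 1 om z.+1 e01).
- by [].
have h m z' := hit_prob_itv m (fun i => om i.+1) z' e01.
change (survival (om 0%N) (step_avg (hit_prob eps n (fun i => om i.+1)) z) <=
  survival (om 0%N) (step_avg (hit_prob eps n.+1 (fun i => om i.+1)) z)).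
apply: le_survival;
  [by case/andP: (step_avg_itv z (h n))|by apply: le_step_avg => // z'; exact: IH|].
by case/andP: (step_avg_itv z (h n.+1)).
Qed.

End recursion.

(** * The branching random walk in a fixed environment *)

Section quenched.
Context d (Omega : measurableType d) (R : realType).
Variables (mu : probability (measurableTypeR R) R) (F : int -> law R).
Variables (P : {measure set Omega -> \bar R}).
Variables (N : seq nat -> {mfun Omega >-> nat}).
Variables (D : seq nat -> {mfun Omega >-> measurableTypeR R}).
Hypothesis PT : P setT = 1%E.
Hypothesis HQ : is_quenched_law mu F P N D.

Definition jump_weight (j : nat) : R := fine (mu [set (1 - j%:R : R)]).

Definition label (a : seq nat + seq nat) : seq nat :=
  match a with inl u => u | inr u => u end.

(** The event that the subtree of [v] climbs [z] levels within [n] generations,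
    cut into countably many pieces according to the displacements [1 - j].  In
    this form it is visibly built from the variables attached to the subtree;
    displacements of another form have probability 0. *)
Fixpoint reach (n : nat) (v : seq nat) (z : nat) : set Omega :=
  if z is z'.+1 then
    if n is n'.+1 then
      \bigcup_i ([set w | (i < N v w)%N] `&`
        \bigcup_j ((D (i :: v) @^-1` [set (1 - j%:R : R)]) `&` reach n' (i :: v) (z' + j)))
    else set0
  else setT.

(** The displacement of [u] from its parent is part of the [z] levels. *)
Definition hit n (u : seq nat) (z : nat) : set Omega :=
  \bigcup_j ((D u @^-1` [set (1 - j%:R : R)]) `&` reach n u (z + j)).

Let Gen (a : seq nat + seq nat) : set (set Omega) :=
  match a with inl u => generated (N u) | inr u => generated (D u) end.

Let Gen_setI a : setI_closed (Gen a).
Proof.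
by case: a => u _ _ [B mB <-] [C mC <-]; exists (B `&` C);
  rewrite ?setTI ?preimage_setI//; exact: measurableI.
Qed.

Let Gen_meas a : Gen a `<=` measurable.
Proof. by case: a => u _ [B mB <-]; exact: measurable_funP. Qed.

Let sub (v : seq nat) : set (seq nat + seq nat) := [set a | suffix v (label a)].
Let sub' (v : seq nat) : set (seq nat + seq nat) := [set a | suffix v (label a) /\ a <> inr v].
Let sublt k v : set (seq nat + seq nat) :=
  [set a | exists2 i, (i < k)%N & suffix (i :: v) (label a)].

Let suffix_cons i (v u : seq nat) : suffix (i :: v) u -> suffix v u.
Proof. by move=> /suffixP[s ->]; apply/suffixP; exists (rcons s i); rewrite cat_rcons. Qed.

Let suffix_cons_self i (v : seq nat) : suffix (i :: v) v -> False.
Proof. by move/size_suffix; rewrite /= ltnn. Qed.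

Let suffix_cons_inj i k (v u : seq nat) : suffix (i :: v) u -> suffix (k :: v) u -> i = k.
Proof. by rewrite !suffixE /= => /eqP -> /eqP[]. Qed.

Let N_joint (v : seq nat) (B : set nat) (S : set (seq nat + seq nat)) : S (inl v) -> joint Gen S (N v @^-1` B).
Proof. by move=> Sv; apply: joint_sub Sv _; exists B => //; rewrite setTI. Qed.

Let D_joint (v : seq nat) (y : R) (S : set (seq nat + seq nat)) : S (inr v) -> joint Gen S (D v @^-1` [set y]).
Proof. by move=> Sv; apply: joint_sub Sv _; exists [set y] => //; rewrite setTI. Qed.

(** The displacement of [v] itself does not enter, so that the event is
    independent of it; hence [sub'] and not [sub]. *)
Let reach_joint n v z : joint Gen (sub' v) (reach n v z).
Proof.
elim: n v z => [|n IH] v [|z] /=; [exact: jointT|exact: joint0|exact: jointT|].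
apply: joint_bigcup => i; apply: joint_setI.
  by apply: (@N_joint v [set m | (i < m)%N]); split => //; exact: suffix_refl.
apply: joint_bigcup => j; apply: joint_setI.
  apply: D_joint; split; last by move=> [] /(congr1 size)/= /esym/n_Sn.
  exact/(@suffix_cons i)/suffix_refl.
apply: (le_joint (IH _ _)) => a [ia _]; split; first exact: suffix_cons ia.
by move=> av; move: ia; rewrite av => /suffix_cons_self.
Qed.

Let hit_joint n u z : joint Gen (sub u) (hit n u z).
Proof.
apply: joint_bigcup => j; apply: joint_setI; first by apply: D_joint; exact: suffix_refl.
by apply: (le_joint (@reach_joint n u (z + j)%N)) => a [].
Qed.

Lemma reach_measurable n v z : measurable (reach n v z).
Proof. exact: (joint_measurable Gen_meas (@reach_joint n v z)). Qed.

Lemma hit_measurable n v z : measurable (hit n v z).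
Proof. exact: (joint_measurable Gen_meas (@hit_joint n v z)). Qed.

Let indep := joint_independent Gen_setI Gen_meas PT (let: And3 _ _ H := HQ in H).

Let PC A : measurable A -> P (~` A) = (1 - P A)%E.
Proof.
move=> mA; rewrite -PT -setTD measureD ?setTI//.
by apply: (@le_lt_trans _ _ 1%E); [rewrite -PT|exact: ltry].
Qed.

Lemma hit_series n u z :
  P (hit n u z) = (\sum_(j <oo) (jump_weight j)%:E * P (reach n u (z + j)))%E.
Proof.
have [_ HD _] := HQ.
rewrite /hit measure_semi_bigcup.
- apply: eq_eseriesr => j _; rewrite (@indep [set inr u] (sub' u)).
  + by rewrite HD// /jump_weight fineK// fin_num_measure.
  + by move=> a -> [].
  + exact: D_joint.
  + exact: reach_joint.
- move=> j; apply: measurableI; last exact: reach_measurable.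
  exact: (joint_measurable Gen_meas (D_joint _ (S := setT) I)).
- move=> i j _ _ [x [[/= -> _] [+ _]]].
  by move=> /= /addrI/oppr_inj/eqP; rewrite eqr_nat => /eqP.
- exact: hit_measurable.
Qed.

Let no_hit (k n : nat) (v : seq nat) (z : nat) := \big[setI/setT]_(i < k) ~` hit n (nat_of_ord i :: v) z.

Let no_hitE k n v z : no_hit k n v z = \bigcap_(i < k) ~` hit n (i :: v) z.
Proof. by rewrite (bigcap_mkord k (fun i => ~` hit n (i :: v) z)). Qed.

Let no_hit_joint k n v z : joint Gen (sublt k v) (no_hit k n v z).
Proof.
rewrite /no_hit; elim: k => [|k IH]; first by rewrite big_ord0; exact: jointT.
rewrite big_ord_recr /=; apply: joint_setI.
  by apply: (le_joint IH) => a [i ik ia]; exists i => //; exact: ltnW.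
apply: joint_setC; apply: (le_joint (@hit_joint _ _ _)) => a ka.
by exists k.
Qed.

Let P_no_hit k n v z q : (forall i, P (hit n (i :: v) z) = q%:E) ->
  P (no_hit k n v z) = ((1 - q) ^+ k)%:E.
Proof.
move=> Pq; elim: k => [|k IH]; rewrite /no_hit; first by rewrite big_ord0 expr0.
rewrite big_ord_recr /= (@indep (sublt k v) (sub (k :: v))).
- by rewrite -/(no_hit k n v z) IH PC ?Pq -?EFinB -?EFinM ?exprSr//; exact: hit_measurable.
- by move=> a [i ik ia] /(suffix_cons_inj ia) iE; rewrite iE ltnn in ik.
- exact: no_hit_joint.
- by apply: joint_setC; exact: hit_joint.
Qed.

(** Given [k] children, the subtrees of the children, each together with the
    displacement of its root, carry disjoint sets of variables; so the
    probability that all [k] fail is the [k]-th power of that for one child. *)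
Lemma reach_prob n v z : P (reach n v z) =
  (hit_prob jump_weight 1 n (fun i => F (size v + i).+1%:Z) z)%:E.
Proof.
have [HN _ _] := HQ.
have w0 j : 0 <= jump_weight j by exact: fine_ge0.
have w1 : (\sum_(j <oo) (jump_weight j)%:E <= 1)%E.
  rewrite -(@probability_setT _ _ _ mu).
  apply: (@le_trans _ _ (mu (\bigcup_j [set (1 - j%:R : R)]))).
    rewrite (@measure_semi_bigcup _ _ _ mu)//.
    - by apply: lee_nneseries => j _; rewrite /jump_weight ?fineK ?fin_num_measure ?lee_fin ?fine_ge0.
    - move=> i j _ _ [x [/= -> ]].
      by move=> /= /addrI/oppr_inj/eqP; rewrite eqr_nat => /eqP.
    - exact: bigcupT_measurable.
  apply: le_measure; rewrite ?inE//; exact: bigcupT_measurable.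
elim: n v z => [|n IH] v [|z] /=; rewrite ?PT ?measure0//.
set om := fun i : nat => F (size v + i.+1).+1%:Z.
set q := step_avg _ _ _.
have h01 z' : 0 <= hit_prob jump_weight 1 n om z' <= 1.
  by apply: hit_prob_itv => //; rewrite ler01 lexx.
have Pq i : P (hit n (i :: v) z) = q%:E.
  rewrite hit_series /q step_avgE//; apply: eq_eseriesr => j _.
  rewrite IH EFinM; congr (_ * (hit_prob _ _ _ _ _)%:E)%E.
  by apply/funext => l; rewrite /om /= addSnnS.
have q01 : 0 <= q <= 1 by exact: step_avg_itv.
rewrite survivalE// addn0.
have -> : \bigcup_i ([set w | (i < N v w)%N] `&`
  \bigcup_j ((D (i :: v) @^-1` [set (1 - j%:R : R)]) `&` reach n (i :: v) (z + j))) =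
  \bigcup_k ((N v @^-1` [set k]) `&` ~` no_hit k n v z).
  apply/seteqP; split => x.
    move=> [i _ [/= iN hx]]; exists (N v x) => //; split => // nh.
    suff: (~` hit n (i :: v) z) x by exact.
    by move: nh; rewrite no_hitE; apply.
  move=> [k _ [/= Nk nh]]; apply: contrapT => H; apply: nh.
  by rewrite no_hitE => i /= ik hx; apply: H; exists i => //; split => //=; rewrite Nk.
have mnh k : measurable (no_hit k n v z).
  exact: (joint_measurable Gen_meas (@no_hit_joint _ _ _ _)).
have mN k : measurable (N v @^-1` [set k]).
  by exact: (joint_measurable Gen_meas (N_joint _ (S := setT) I)).
rewrite measure_semi_bigcup.
- apply: eq_eseriesr => k _; rewrite (@indep [set inl v] (sublt k v)).
  + by rewrite HN PC// (P_no_hit k Pq) muleC.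
  + by move=> a -> [i _] /suffix_cons_self.
  + exact: N_joint.
  + by apply: joint_setC; exact: no_hit_joint.
- by move=> k; apply: measurableI => //; exact: measurableC.
- by move=> i j _ _ [x [[/= -> _] [/= -> _]]].
- by apply: bigcupT_measurable => k; apply: measurableI => //; exact: measurableC.
Qed.

End quenched.

(** * The maximum *)

Section maximum_event.
Context d (Omega : measurableType d) (R : realType).
Variables (N : seq nat -> {mfun Omega >-> nat}).
Variables (D : seq nat -> {mfun Omega >-> measurableTypeR R}).

Let n_ (w : Omega) : seq nat -> nat := N ^~ w.
Let d_ (w : Omega) : seq nat -> R := D ^~ w.

Definition lattice_displacements : set Omega :=
  [set w | forall u, exists j : nat, D u w = (1 - j%:R : R)].

Lemma alive_catr (n : seq nat -> nat) (s v : seq nat) : alive n (s ++ v) -> alive n v.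
Proof. by elim: s => [//|i s IH] /= /andP[/IH]. Qed.

Lemma reach_alive n v z w : reach N D n v z w -> alive (n_ w) v ->
  exists2 u, alive (n_ w) u & position (d_ w) v + z%:R <= position (d_ w) u.
Proof.
elim: n v z => [|n IH] v [|z] //=; do ?by move=> _ av; exists v => //; rewrite addr0.
move=> [i _ [/= iN [j _ [/= Dj /IH H]]]] av.
have [|u au pu] := H; first by rewrite /= av.
exists u => //; apply: le_trans pu; have Ej : d_ w (i :: v) = 1 - j%:R := Dj.
rewrite /= Ej natrD -natr1; lra.
Qed.

(** Induction on the line of descent from [v], read from its older end. *)
Lemma alive_reach w s v z : lattice_displacements w -> alive (n_ w) (s ++ v) ->
  position (d_ w) v + z%:R <= position (d_ w) (s ++ v) ->
  exists n, reach N D n v z w.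
Proof.
move=> lw; elim/last_ind: s v z => [|s i IH] v [|z]; do ?by move=> _ _; exists 0%N.
  by rewrite /= gerDl lern0.
rewrite cat_rcons => asv psv.
have [j Dj] := lw (i :: v); have Ej : d_ w (i :: v) = 1 - j%:R := Dj.
have [|n Hn] := IH (i :: v) (z + j)%N asv.
  by apply: le_trans psv; rewrite /= Ej natrD -natr1; lra.
exists n.+1; exists i => //; split; last by exists j.
by have /andP[] := alive_catr asv.
Qed.

Lemma position_int w u : lattice_displacements w -> exists k : int, position (d_ w) u = k%:~R.
Proof.
move=> lw; elim: u => [|i u [k IH]]; first by exists 0.
have [j Dj] := lw (i :: u); have Ej : d_ w (i :: u) = 1 - j%:R := Dj.
by exists (k + 1 - j%:Z); rewrite /= IH Ej !intrD mulrNz addrA.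
Qed.

(** Positions are integers, so if all of them are below [x], then they are at
    most [x - 1], and so is their supremum. *)
Lemma maximum_reach w (x : nat) : lattice_displacements w ->
  (x%:R%:E <= maximum (n_ w) (d_ w))%E <-> exists n, reach N D n [::] x w.
Proof.
move=> lw; split; last first.
  move=> [n /reach_alive /(_ isT) [u au pu]].
  apply: (@le_trans _ _ (position (d_ w) u)%:E); last by apply: ereal_sup_ubound; exists u.
  by move: pu; rewrite add0r lee_fin.
move=> xM; apply: contrapT => H.
suff: (maximum (n_ w) (d_ w) <= (x%:R - 1)%:E)%E.
  by move=> /(le_trans xM); rewrite lee_fin; lra.
apply: ge_ereal_sup => _ [u au <-]; rewrite lee_fin.
have [k pk] := position_int u lw.
rewrite leNgt; apply/negP => Hx; apply: H.
apply: (@alive_reach w u [::]) => //; rewrite ?cats0// add0r.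
rewrite pk; move: Hx; rewrite pk.
rewrite -[x%:R]/((x%:Z)%:~R) -[1]/(1%:~R) -intrB ltr_int ler_int.
by rewrite -lezD1 subrK.
Qed.

Lemma alive_measurable u : measurable [set w | alive (n_ w) u].
Proof.
elim: u => [|i u IH] /=; first by rewrite [X in measurable X](_ : _ = setT)//; apply/seteqP.
rewrite [X in measurable X](_ : _ = [set w | alive (n_ w) u] `&` N u @^-1` [set m | (i < m)%N]).
  by apply: measurableI => //; rewrite -[X in measurable X]setTI; exact: measurable_funP.
by apply/seteqP; split => w /= => [/andP[]//|[-> ->]].
Qed.

Lemma position_measurable u : measurable_fun setT (fun w => position (d_ w) u : measurableTypeR R).
Proof.
elim: u => [|i u IH] /=; first exact: measurable_cst.
by apply: measurable_funD => //; exact: (measurable_funP (D (i :: u))).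
Qed.

Lemma le_ereal_supP (S : set (\bar R)) (x : R) : (x%:E <= ereal_sup S)%E <->
  forall k, exists2 s, S s & ((x - k.+1%:R^-1)%:E < s)%E.
Proof.
split => [xS k|H].
  have [|y Sy] := @ereal_sup_gt _ S (x - k.+1%:R^-1)%:E; last by exists y.
  by apply: lt_le_trans xS; rewrite lte_fin ltrBlDr ltrDl invr_gt0.
apply/lee_addgt0Pr => e e0.
have [s Ss] := H (Num.truncn e^-1).
have : ((Num.truncn e^-1).+1%:R^-1 <= e :> R).
  by rewrite invf_ple ?posrE ?invr_gt0// ltW// truncnS_gt.
move=> ke xs; rewrite -leeBlDr// -EFinB.
apply: (@le_trans _ _ s); last exact: ereal_sup_ubound.
by apply: ltW; apply: le_lt_trans xs; rewrite lee_fin lerD2l lerN2.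
Qed.

Lemma labels_countable : exists lab : nat -> seq nat, forall u, exists m, lab m = u.
Proof.
exists (fun m => odflt [::] (unpickle m)) => u.
by exists (pickle u); rewrite pickleK.
Qed.

Lemma maximum_measurable (x : R) :
  measurable [set w | (x%:E <= maximum (n_ w) (d_ w))%E].
Proof.
have [lab lab_surj] := labels_countable.
rewrite [X in measurable X](_ : _ = \bigcap_k \bigcup_m
    ([set w | alive (n_ w) (lab m)] `&`
     [set w | (x - k.+1%:R^-1 < position (d_ w) (lab m))%R])); last first.
  apply/seteqP; split => w /=.
    move=> /le_ereal_supP H k _; have [_ [u au <-] pu] := H k.
    have [m mu] := lab_surj u; exists m => //; rewrite mu.
    by split => //=; rewrite -lte_fin.
  move=> H; apply/le_ereal_supP => k; have [m _ [au pu]] := H k I.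
  by exists (position (d_ w) (lab m))%:E; [exists (lab m)|rewrite lte_fin].
apply: bigcapT_measurable => k; apply: bigcupT_measurable => m.
apply: measurableI; first exact: alive_measurable.
rewrite -[X in measurable X]setTI.
rewrite [X in setT `&` X](_ : _ =
    (fun w => position (d_ w) (lab m)) @^-1` `](x - k.+1%:R^-1), +oo[%classic).
  exact: position_measurable.
by apply/seteqP; split => w /=; rewrite in_itv/= andbT.
Qed.

Variables (mu : probability (measurableTypeR R) R) (F : int -> law R).
Variables (P : {measure set Omega -> \bar R}).
Hypothesis PT : P setT = 1%E.
Hypothesis HQ : is_quenched_law mu F P N D.
Hypothesis mu_lattice : mu (\bigcup_j [set (1 - j%:R : R)]) = 1%E.

Lemma reach_mono n v z : reach N D n v z `<=` reach N D n.+1 v z.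
Proof.
elim: n v z => [|n IH] v [|z]//.
move=> w [i _ [/= iN [j _ [Dj /IH H]]]].
by exists i => //; split => //; exists j.
Qed.

(** The two events agree off the null event that some displacement is not of
    the form [1 - j]. *)
Lemma maximum_prob (x : nat) :
  P [set w | (x%:R%:E <= maximum (n_ w) (d_ w))%E] =
  P (\bigcup_n reach N D n [::] x).
Proof.
have mr : measurable (\bigcup_n reach N D n [::] x).
  by apply: bigcupT_measurable => n; exact: reach_measurable.
pose L := \bigcup_j [set (1 - j%:R : R)].
have mL : measurable (L : set (measurableTypeR R)) by exact: bigcupT_measurable.
have [lab lab_surj] := labels_countable.
pose B m := D (lab m) @^-1` ~` L.
have mB m : measurable (B m).
  by rewrite -[X in measurable X]setTI; apply: measurable_funP => //; exact: measurableC.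
have B0 : P (\bigcup_m B m) = 0.
  apply/eqP; rewrite eq_le measure_ge0 andbT.
  apply: (le_trans (generalized_Boole_inequality _ mB _)).
    exact: bigcupT_measurable.
  rewrite eseries0// => m _ _; have [_ HD _] := HQ; rewrite HD; last exact: measurableC.
  by rewrite -setTD measureD ?setTI//= ?probability_setT ?mu_lattice ?subee// ltry.
have lat w : ~ (\bigcup_m B m) w -> lattice_displacements w.
  move=> nB u; have : L (D u w).
    by apply: contrapT => Lu; apply: nB; have [m mu'] := lab_surj u; exists m => //; rewrite /B mu'.
  by move=> [j _ /=]; exists j.
have mBB : measurable (\bigcup_m B m) by exact: bigcupT_measurable.
have PI A : measurable A -> P A = P (A `\` \bigcup_m B m).
  move=> mA; have := @measureDI _ _ _ P A (\bigcup_m B m) mA mBB.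
  rewrite (@subset_measure0 _ _ _ P (A `&` \bigcup_m B m) (\bigcup_m B m)) ?adde0//.
  exact: measurableI.
rewrite PI; last exact: maximum_measurable.
rewrite [RHS]PI//; congr (P _); apply/seteqP; split => w [/= Aw nB]; split => //.
  by have [n Hn] := (maximum_reach x (lat w nB)).1 Aw; exists n.
by case: Aw => n _ Hn; apply/(maximum_reach x (lat w nB)); exists n.
Qed.

Lemma maximum_prob_cvg (x : nat) :
  ((hit_prob (jump_weight mu) 1 n (fun i => F i.+1%:Z) x)%:E @[n --> \oo] -->
   P [set w | (x%:R%:E <= maximum (n_ w) (d_ w))%E])%E.
Proof.
rewrite maximum_prob.
under eq_fun do rewrite -[fun i => F i.+1%:Z]/(fun i => F (size (@nil nat) + i)%N.+1%:Z) -(reach_prob PT HQ).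
apply: nondecreasing_cvg_mu.
- by move=> n; exact: reach_measurable.
- by apply: bigcupT_measurable => n; exact: reach_measurable.
- by apply/nondecreasing_seqP => n; apply/subsetPset; exact: reach_mono.
Qed.

End maximum_event.

(** * Measurability in the environment *)

Section law_measurability.
Context (R : realType).
Implicit Types F G : probability nat R.

Lemma prob_le1 F (A : set nat) : 0 <= fine (F A) <= 1.
Proof.
rewrite fine_ge0//= -lee_fin fineK ?fin_num_measure//.
exact: probability_le1.
Qed.

Lemma tv_dist_ge F G A : `|fine (F A) - fine (G A)| <= tv_dist F G.
Proof.
apply: ub_le_sup; last by exists A.
exists 1 => _ [B _ <-].
have /andP[a0 a1] := prob_le1 F B; have /andP[b0 b1] := prob_le1 G B.
by rewrite ler_norml; apply/andP; split; lra.
Qed.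

(** Evaluation at a set is 1-Lipschitz for the total variation distance. *)
Lemma measurable_law_eval (A : set nat) :
  measurable_fun setT (fun F : law R => (F : probability nat R) A).
Proof.
suff: measurable_fun setT (fun F : law R => fine ((F : probability nat R) A)).
  move=> /measurable_EFinP; apply: eq_measurable_fun => F _ /=.
  by rewrite fineK// fin_num_measure.
move=> mD; apply: (measurability _ (RGenOInfty.measurableE R)) => //.
move=> /= _ [_ [c ->] <-]; rewrite setTI; apply: sub_sigma_algebra => F /=.
rewrite in_itv/= andbT => cF; exists (fine (F A) - c); first by rewrite subr_gt0.
move=> G FG; rewrite /= in_itv/= andbT.
have := le_lt_trans (le_trans (ler_norm _) (tv_dist_ge F G A)) FG; lra.
Qed.

Lemma measurable_nneseries d (T : measurableType d) (h : nat -> T -> \bar R) N :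
  (forall k x, (0 <= h k x)%E) -> (forall k, measurable_fun setT (h k)) ->
  measurable_fun setT (fun x => \sum_(N <= k <oo) h k x)%E.
Proof.
move=> h0 mh.
have H := @ge0_emeasurable_sum _ T R setT h (fun k => N <= k)%N
  (fun k x _ _ => h0 k x) (fun k _ => mh k).
apply: eq_measurable_fun H => x _.
by rewrite [in RHS]eseries_cond; apply: eq_eseriesl => k.
Qed.

Lemma measurable_mean : measurable_fun setT (fun F : law R => mean F).
Proof.
apply: measurable_nneseries => [k F|k]; first by rewrite mule_ge0// lee_fin.
by apply: emeasurable_funM => //; exact: measurable_law_eval.
Qed.

Lemma measurable_second_factorial_moment :
  measurable_fun setT (fun F : law R => second_factorial_moment F).
Proof.
apply: measurable_nneseries => [k F|k]; first by rewrite mule_ge0// lee_fin.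
by apply: emeasurable_funM => //; exact: measurable_law_eval.
Qed.

Lemma measurable_survival d (T : measurableType d) (f : T -> law R) (g : T -> R) :
  measurable_fun setT f -> measurable_fun setT g -> (forall x, 0 <= g x <= 1) ->
  measurable_fun setT (fun x => survival (f x) (g x)).
Proof.
move=> mf mg g01; rewrite /survival; apply: measurableT_comp => //.
apply: measurable_nneseries => [k x|k].
  by rewrite mule_ge0// lee_fin; case/andP: (one_sub_pow_itv k (g01 x)).
apply: emeasurable_funM.
  apply/measurable_EFinP; apply: measurable_funB => //.
  by apply: measurable_funX; exact: measurable_funB.
exact: (measurableT_comp (measurable_law_eval _) mf).
Qed.

End law_measurability.

(** * Stationarity and independence of the environment *)

Section environment_sequences.
Context (R : realType).

Definition env_cylinder : set (set (nat -> law R)) :=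
  [set A | exists n (B : nat -> set (law R)), (forall i, measurable (B i)) /\
    A = [set om | forall i, (i < n)%N -> B i (om i)]].

(** Sequences of laws carry the product sigma-algebra, generated by a pi-system
    on which the law of an i.i.d. environment is a finite product. *)
Definition env_seq : Type := g_sigma_algebraType env_cylinder.
HB.instance Definition _ := Measurable.on env_seq.

Lemma env_cylinder_setI : setI_closed env_cylinder.
Proof.
move=> _ _ [n [B [mB ->]]] [m [C [mC ->]]].
exists (maxn n m), (fun i => (if (i < n)%N then B i else setT) `&`
                            (if (i < m)%N then C i else setT)); split.
  by move=> i; apply: measurableI; case: ifP.
apply/seteqP; split => om /=.
  by move=> [H K] i _; split; case: ifP => // h; [exact: H|exact: K].
move=> H; split => i im.
  by have [] := H i (leq_trans im (leq_maxl _ _)); rewrite im.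
by have [] := H i (leq_trans im (leq_maxr _ _)); rewrite im.
Qed.

Lemma measurable_coord i : measurable_fun setT (fun om : env_seq => om i).
Proof.
move=> _ B mB; rewrite setTI; apply: sub_sigma_algebra.
exists i.+1, (fun j => if j == i then B else setT); split.
  by move=> j; case: ifP.
apply/seteqP; split => om /=; first by move=> H j _; case: eqP => // ->.
by move=> /(_ i (ltnSn i)); rewrite eqxx.
Qed.

Lemma measurable_into_env d (T : measurableType d) (f : T -> env_seq) :
  (forall i, measurable_fun setT (fun x => f x i)) -> measurable_fun setT f.
Proof.
move=> mf; apply: (@measurability _ _ T env_seq setT f env_cylinder) => // _ [_ [n [B [mB ->]]] <-].
rewrite setTI (_ : _ @^-1` _ = \bigcap_(i in [set i | (i < n)%N]) ((fun x => f x i) @^-1` (B i))).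
  by apply: bigcap_measurableType => i _; rewrite -[X in measurable X]setTI; exact: mf.
by apply/seteqP; split => x /=.
Qed.

Lemma measurable_shift : measurable_fun setT (fun om : env_seq => (fun i => om i.+1) : env_seq).
Proof. by apply: measurable_into_env => i; exact: measurable_coord. Qed.

Lemma measurable_hit_prob (w : nat -> R) eps n z :
  (forall j, 0 <= w j) -> (\sum_(j <oo) (w j)%:E <= 1)%E -> 0 <= eps <= 1 ->
  measurable_fun setT (fun om : env_seq => hit_prob w eps n om z).
Proof.
move=> w0 w1 e01; elim: n z => [|n IH] [|z] /=; do ?exact: measurable_cst.
have h om z' := hit_prob_itv w0 w1 n om z' e01.
apply: measurable_survival; first exact: measurable_coord.
  apply: measurableT_comp => //; apply: measurable_nneseries => [j om|j].
    by rewrite lee_fin mulr_ge0//; case/andP: (h (fun i => om i.+1) (z + j)%N).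
  apply/measurable_EFinP; apply: measurable_funM => //.
  exact: (measurableT_comp (IH _) measurable_shift).
by move=> om; apply: step_avg_itv.
Qed.

End environment_sequences.

Section iid.
Context d (E : measurableType d) (R : realType).
Variables (PE : probability E R) (F : int -> E -> law R).
Hypothesis iidF : iid_environment PE F.

Definition env_from (k : nat) (e : E) : env_seq R := fun i => F (k + i).+1%:Z e.

Let mF k : measurable_fun setT (F k). Proof. by have [H _ _] := iidF. Qed.

Lemma measurable_env_from k : measurable_fun setT (env_from k).
Proof. by apply: measurable_into_env => i; exact: mF. Qed.

Let Gen k := generated (F k).

Let Gen_setI k : setI_closed (Gen k).
Proof.
by move=> _ _ [B mB <-] [C mC <-]; exists (B `&` C);
  rewrite ?setTI ?preimage_setI//; exact: measurableI.
Qed.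

Let Gen_meas k : Gen k `<=` measurable.
Proof. by move=> _ [B mB <-]; exact: mF. Qed.

Let env_cylinder_prob k n (B : nat -> set (law R)) : (forall i, measurable (B i)) ->
  PE (env_from k @^-1` [set om | forall i, (i < n)%N -> B i (om i)]) =
  (\prod_(i <- iota 0 n) PE (F 0 @^-1` B i))%E.
Proof.
move=> mB; have [_ ind idd] := iidF.
pose J := [seq (k + i).+1%:Z | i <- iota 0 n].
pose A (z : int) := F z @^-1` B ((absz z).-1 - k)%N.
have AE i : A (k + i).+1%:Z = F (k + i).+1%:Z @^-1` B i by rewrite /A /= addKn.
have -> : env_from k @^-1` [set om | forall i, (i < n)%N -> B i (om i)] =
    \big[setI/setT]_(z <- J) A z.
  apply/seteqP; split => e.
    move=> H; apply/in_bigI => z /mapP[i]; rewrite mem_iota => /= ni ->.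
    by rewrite AE; exact: H.
  move=> /in_bigI H i ni; have := H (k + i).+1%:Z; rewrite AE; apply.
  by apply/mapP; exists i => //; rewrite mem_iota.
rewrite ind; first 1 last.
- by rewrite map_inj_uniq ?iota_uniq// => i j [] /addnI.
- by move=> z _; exists (B ((absz z).-1 - k)%N) => //; rewrite setTI.
by rewrite big_map; apply: eq_bigr => i _; rewrite AE; exact: idd.
Qed.

Lemma env_from_stationary k (A : set (env_seq R)) : measurable A ->
  PE (env_from k @^-1` A) = PE (env_from 0 @^-1` A).
Proof.
move=> mA.
pose X j : {mfun E >-> env_seq R} :=
  HB.pack (env_from j) (isMeasurableFun.Build _ _ _ _ _ (measurable_env_from j)).
change (distribution PE (X k) A = distribution PE (X 0%N) A).
apply: (@measure_unique _ _ (env_seq R) (@env_cylinder R) (fun=> setT) erefl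
  (@env_cylinder_setI R) _ _ (distribution PE (X k)) (distribution PE (X 0%N))) => //.
- by move=> _; exists 0%N, (fun=> setT); split => //; apply/seteqP.
- by rewrite bigcup_const//; exists 0%N.
- by move=> _ [n [B [mB ->]]]; exact: (etrans (env_cylinder_prob k n mB) (esym (env_cylinder_prob 0 n mB))).
- by move=> _; rewrite /= probability_setT ltry.
Qed.

Lemma first_env_independent (A : set (law R)) (B : set (env_seq R)) :
  measurable A -> measurable B ->
  PE (F 1 @^-1` A `&` env_from 1 @^-1` B) =
  (PE (F 1 @^-1` A) * PE (env_from 1 @^-1` B))%E.
Proof.
move=> mA mB; have [_ ind idd] := iidF.
apply: (joint_independent Gen_setI Gen_meas (probability_setT PE) ind
  (S := [set 1%:Z]) (S' := [set z | z <> 1%:Z])).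
- by move=> i -> /(_ erefl).
- by apply: (@joint_sub _ _ _ _ _ 1%:Z) => //; exists A => //; rewrite setTI.
- move: B mB; apply: smallest_sub.
    split => [|C|C].
    + by rewrite /= preimage_set0; exact: joint0.
    + by rewrite /= setTD preimage_setC; exact: joint_setC.
    + by move=> /= HC; rewrite preimage_bigcup; exact: joint_bigcup.
  move=> _ [n [B [mB ->]]] /=; pose J := [seq i.+2%:Z | i <- iota 0 n].
  apply: sub_sigma_algebra; exists J, (fun z => F z @^-1` B ((absz z).-2)%N); split.
  + by rewrite map_inj_uniq ?iota_uniq// => i j [].
  + by move=> z /mapP[i _ ->]; split => //; exists (B i) => //; rewrite setTI.
  + apply/seteqP; split => e.
      move=> H; apply/in_bigI => z /mapP[i]; rewrite mem_iota => /= ni ->.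
      exact: H.
    move=> /in_bigI H i ni; apply: (H i.+2%:Z).
    by apply/mapP; exists i => //; rewrite mem_iota.
Qed.

Local Open Scope ereal_scope.

Lemma integral_env_from k (b : env_seq R -> \bar R) : measurable_fun setT b ->
  (forall om, 0 <= b om) ->
  \int[PE]_e b (env_from k e) = \int[PE]_e b (env_from 0 e).
Proof.
move=> mb b0.
have H j : \int[PE]_e b (env_from j e) = \int[pushforward PE (env_from j)]_om b om.
  by rewrite ge0_integral_pushforward ?preimage_setT//; exact: measurable_env_from.
rewrite !H.
pose X j : {mfun E >-> env_seq R} :=
  HB.pack (env_from j) (isMeasurableFun.Build _ _ _ _ _ (measurable_env_from j)).
apply: (@eq_measure_integral _ _ _ setT (distribution PE (X 0%N)) (distribution PE (X k))).
by move=> A mA _; exact: env_from_stationary.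
Qed.

Lemma integral_first_env (a : law R -> \bar R) (b : env_seq R -> \bar R) :
  measurable_fun setT a -> measurable_fun setT b ->
  (forall G, 0 <= a G) -> (forall om, 0 <= b om) ->
  \int[PE]_e (a (F 1 e) * b (env_from 1 e)) =
  (\int[PE]_e a (F 1 e)) * (\int[PE]_e b (env_from 0 e)).
Proof.
move=> ma mb a0 b0; rewrite -(integral_env_from 1 mb b0).
pose X : {mfun E >-> law R} := HB.pack (F 1) (isMeasurableFun.Build _ _ _ _ _ (mF 1)).
pose Y : {mfun E >-> env_seq R} :=
  HB.pack (env_from 1) (isMeasurableFun.Build _ _ _ _ _ (measurable_env_from 1)).
have mXY : measurable_fun setT (fun e => (X e, Y e)).
  by apply: measurable_fun_pair; exact: measurable_funP.
pose Z : {mfun E >-> (law R * env_seq R)%type} :=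
  HB.pack (fun e => (X e, Y e)) (isMeasurableFun.Build _ _ _ _ _ mXY).
pose f (z : law R * env_seq R) := a z.1 * b z.2.
have mf : measurable_fun setT f.
  by apply: emeasurable_funM; [exact: (measurableT_comp ma)|exact: (measurableT_comp mb)].
have f0 z : 0 <= f z by rewrite mule_ge0.
transitivity (\int[distribution PE Z]_z f z).
  by rewrite ge0_integral_distribution.
transitivity (\int[distribution PE X \x distribution PE Y]_z f z).
  apply: eq_measure_integral => A mA _; apply/esym.
  apply: (@product_measure_unique _ _ _ _ _ (distribution PE X) (distribution PE Y)
    (distribution PE Z)) => // {mA}A B mA mB.
  by rewrite /distribution /pushforward/= -first_env_independent.
rewrite (fubini_tonelli1 f)// /fubini_F.
transitivity (\int[distribution PE X]_x (a x * \int[distribution PE Y]_y b y)).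
  by apply: eq_integral => x _; rewrite /f/= ge0_integralZl.
rewrite ge0_integralZr//; last exact: integral_ge0.
by rewrite !ge0_integral_distribution.
Qed.

End iid.

(** * Recursive inequalities for the annealed hitting probabilities *)

Section step_average_bounds.
Context (R : realType).
Variable w : nat -> R.
Hypothesis w_ge0 : forall j, 0 <= w j.
Hypothesis w_le1 : (\sum_(j <oo) (w j)%:E <= 1)%E.

Lemma step_avg_le_exp (f : nat -> R) (z0 : nat) (lam M C t : R) :
  (forall z, 0 <= f z <= 1) -> 0 <= C ->
  (\sum_(j <oo) (w j * expR (lam * (1 - j%:R)))%:E = M%:E)%E ->
  (forall j, f (z0 + j)%N <= C * expR (- lam * (t + j%:R))) ->
  step_avg w f z0 <= C * expR (- lam * (t + 1)) * M.
Proof.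
move=> f01 C0 HM fC; rewrite -lee_fin step_avgE// EFinM -HM -nneseriesZl; last first.
  by move=> j _; rewrite lee_fin mulr_ge0// expR_ge0.
apply: lee_nneseries => j.
  by move=> _ _; rewrite lee_fin mulr_ge0//; case/andP: (f01 (z0 + j)%N).
move=> _; rewrite -EFinM lee_fin mulrCA -mulrA -expRD.
rewrite (_ : - lam * (t + 1) + lam * (1 - j%:R) = - lam * (t + j%:R)); last ring.
by rewrite ler_wpM2l.
Qed.

Lemma young_powR (a f th : R) : 0 < a -> 0 <= f -> 0 < th ->
  (1 + th) * (a `^ th * f) <= f `^ (1 + th) + th * a `^ (1 + th).
Proof.
move=> a0 f0 th0; have p0 : 0 < 1 + th by rewrite addr_gt0.
have q0 : 0 < (1 + th) / th by rewrite divr_gt0.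
have pq : (1 + th)^-1 + ((1 + th) / th)^-1 = 1 :> R.
  by field; rewrite !gt_eqF.
have := conjugate_powR f0 (powR_ge0 a th) p0 q0 pq.
rewrite -powRrM (_ : th * ((1 + th) / th) = 1 + th); last by field; rewrite gt_eqF.
move=> H; rewrite [a `^ th * f]mulrC.
apply: le_trans (ler_wpM2l (ltW p0) H) _.
rewrite le_eqVlt; apply/orP; left; apply/eqP.
by field; rewrite !gt_eqF.
Qed.

(** Hölder's inequality with the exponential weights [expR (lam * (1 - j))];
    a plain power-mean inequality would not use the bias of the walk. *)
Lemma step_avg_powR (f : nat -> R) (z : nat) (lam M th : R) :
  (forall z, 0 <= f z <= 1) -> 0 < M -> 0 < th ->
  (\sum_(j <oo) (w j * expR (lam * (1 - j%:R)))%:E = M%:E)%E ->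
  ((step_avg w f z `^ (1 + th))%:E <= (M `^ th)%:E *
    \sum_(j <oo) (w j * expR (- (lam * th) * (1 - j%:R)) * f (z + j)%N `^ (1 + th))%:E)%E.
Proof.
move=> f01 M0 th0 HM; set S := step_avg w f z.
set T := (\sum_(j <oo) _)%E.
have p0 : 0 < 1 + th by rewrite addr_gt0.
have T0 : (0 <= T)%E.
  by apply: nneseries_ge0 => j _ _; rewrite lee_fin !mulr_ge0// ?expR_ge0 ?powR_ge0.
have S0 : 0 <= S by case/andP: (step_avg_itv w_ge0 w_le1 z f01).
have [S_eq0|Sn0] := eqVneq S 0.
  by rewrite S_eq0 powR0 ?gt_eqF// mule_ge0// lee_fin powR_ge0.
have {Sn0}S_gt0 : 0 < S by rewrite lt_neqAle eq_sym Sn0.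
pose A := S / M; have A0 : 0 < A by rewrite divr_gt0.
have key : (((1 + th) * A `^ th * S)%:E <= T + (th * A `^ (1 + th) * M)%:E)%E.
  rewrite [X in (X <= _)%E]EFinM [X in (_ + X)%E]EFinM /S step_avgE// -HM.
  have ge1 j : 0 <= w j * f (z + j)%N by rewrite mulr_ge0//; case/andP: (f01 (z + j)%N).
  have ge2 j : 0 <= w j * expR (lam * (1 - j%:R)) by rewrite mulr_ge0 ?expR_ge0.
  have ge3 j : 0 <= w j * expR (- (lam * th) * (1 - j%:R)) * f (z + j)%N `^ (1 + th).
    by rewrite !mulr_ge0 ?expR_ge0 ?powR_ge0.
  have ge4 : 0 <= (1 + th) * A `^ th by rewrite mulr_ge0 ?powR_ge0 ?ltW.
  have ge5 : 0 <= th * A `^ (1 + th) by rewrite mulr_ge0 ?powR_ge0 ?ltW.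
  rewrite -!nneseriesZl; do ?by move=> j _; rewrite lee_fin.
  rewrite /T -nneseriesD; first last.
  - by move=> j _ _; rewrite -EFinM lee_fin mulr_ge0.
  - by move=> j _ _; rewrite lee_fin.
  apply: lee_nneseries => j.
    by move=> _ _; rewrite -EFinM lee_fin mulr_ge0.
  move=> _; rewrite -!EFinM -EFinD lee_fin.
  have f0 : 0 <= f (z + j)%N by case/andP: (f01 (z + j)%N).
  set u := lam * (1 - j%:R).
  have -> : - (lam * th) * (1 - j%:R) = - (u * th) by rewrite /u; ring.
  have := young_powR (mulr_gt0 A0 (expR_gt0 u)) f0 th0.
  have -> : (A * expR u) `^ th = A `^ th * expR (u * th).
    by rewrite powRM ?expR_ge0 ?(ltW A0)// expRM.
  have -> : (A * expR u) `^ (1 + th) = A `^ (1 + th) * expR (u * (1 + th)).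
    by rewrite powRM ?expR_ge0 ?(ltW A0)// expRM.
  move=> /(ler_wpM2l (mulr_ge0 (w_ge0 j) (expR_ge0 (- (u * th))))).
  have -> : u * (1 + th) = u + u * th by ring.
  have e1 : expR (- (u * th)) * expR (u * th) = 1 by rewrite -expRD addNr expR0.
  rewrite expRD.
  rewrite (_ : w j * expR (- (u * th)) * ((1 + th) * (A `^ th * expR (u * th) * f (z + j)%N)) =
    (expR (- (u * th)) * expR (u * th)) * ((1 + th) * A `^ th * (w j * f (z + j)%N))); last ring.
  rewrite mulrDr.
  rewrite (_ : w j * expR (- (u * th)) * (th * (A `^ (1 + th) * (expR u * expR (u * th)))) =
    (expR (- (u * th)) * expR (u * th)) * (th * A `^ (1 + th) * (w j * expR u))); last ring.
  by rewrite e1 !mul1r.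
have SE : S = A * M by rewrite /A divfK// gt_eqF.
have pE : A `^ (1 + th) = A * A `^ th.
  by rewrite powRD ?gt_eqF ?implybT// powRr1// ltW.
have pS : S `^ (1 + th) = S * S `^ th.
  by rewrite powRD ?gt_eqF ?implybT// powRr1.
have {key} : (((A `^ th) * S)%:E <= T)%E.
  have -> : A `^ th * S = (1 + th) * A `^ th * S - th * A `^ (1 + th) * M.
    by rewrite SE pE; ring.
  by rewrite EFinB leeBlDr.
move=> /(lee_wpmul2l (_ : (0 <= (M `^ th)%:E)%E)); rewrite lee_fin powR_ge0 => /(_ isT).
apply: le_trans; rewrite -EFinM lee_fin mulrA -powRM ?(ltW M0) ?(ltW A0)// [M * A]mulrC -SE.
by rewrite pS mulrC.
Qed.

End step_average_bounds.

Section annealed_recursion.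
Context d (E : measurableType d) (R : realType).
Variables (PE : probability E R) (F : int -> E -> law R).
Hypothesis iidF : iid_environment PE F.
Variable w : nat -> R.
Hypothesis w_ge0 : forall j, 0 <= w j.
Hypothesis w_le1 : (\sum_(j <oo) (w j)%:E <= 1)%E.
Variable eps : R.
Hypothesis eps01 : 0 <= eps <= 1.
Local Open Scope ereal_scope.

Definition annealed_hit (n z : nat) : R :=
  fine (\int[PE]_e (hit_prob w eps n (env_from F 0 e) z)%:E).

Let h01 n om z : (0 <= hit_prob w eps n om z <= 1)%R.
Proof. exact: hit_prob_itv. Qed.

Let avg01 n om z : (0 <= step_avg w (hit_prob w eps n om) z <= 1)%R.
Proof. exact: step_avg_itv. Qed.

Let integral_const (c : \bar R) : \int[PE]_e (cst c) e = c.
Proof.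
by rewrite integral_cst//= [X in _ * X](_ : _ = 1) ?mule1//; exact: (probability_setT PE).
Qed.

Lemma integral_itv01 (f : E -> R) : measurable_fun setT f ->
  (forall e, (0 <= f e <= 1)%R) ->
  0 <= \int[PE]_e (f e)%:E <= 1.
Proof.
move=> mf f01; apply/andP; split.
  by apply: integral_ge0 => e _; rewrite lee_fin; case/andP: (f01 e).
apply: (@le_trans _ _ (\int[PE]_e (cst 1 e))).
  apply: ge0_le_integral => //=.
  - by move=> e _; rewrite lee_fin; case/andP: (f01 e).
  - exact/measurable_EFinP.
  - by move=> e _; rewrite lee_fin; case/andP: (f01 e).
by rewrite integral_const.
Qed.

Lemma measurable_hit_prob_env n z k :
  measurable_fun setT (fun e => hit_prob w eps n (env_from F k e) z).
Proof.
exact: (measurableT_comp (measurable_hit_prob n z w_ge0 w_le1 eps01) (measurable_env_from iidF k)).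
Qed.

Lemma annealed_hitE n z : (annealed_hit n z)%:E =
  \int[PE]_e (hit_prob w eps n (env_from F 0 e) z)%:E.
Proof.
have /andP[i0 i1] := integral_itv01 (measurable_hit_prob_env n z 0) (fun e => h01 n _ z).
rewrite /annealed_hit fineK// ge0_fin_numE//; exact: le_lt_trans i1 (ltry _).
Qed.

Lemma annealed_hit_itv n z : (0 <= annealed_hit n z <= 1)%R.
Proof.
rewrite -!lee_fin annealed_hitE.
exact: (integral_itv01 (measurable_hit_prob_env n z 0) (fun e => h01 n _ z)).
Qed.

Lemma annealed_hit0 n : annealed_hit n 0 = eps.
Proof.
apply: EFin_inj; rewrite annealed_hitE.
rewrite (_ : (fun e => _) = cst eps%:E); last by apply/funext => e; case: n.
by rewrite integral_const.
Qed.

Lemma le_annealed_hit_time n z : (annealed_hit n z <= annealed_hit n.+1 z)%R.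
Proof.
rewrite -lee_fin !annealed_hitE; apply: ge0_le_integral => //.
- by move=> e _; rewrite lee_fin; case/andP: (h01 n (env_from F 0 e) z).
- exact/measurable_EFinP/measurable_hit_prob_env.
- exact/measurable_EFinP/measurable_hit_prob_env.
- by move=> e _; rewrite lee_fin; exact: le_hit_prob_time.
Qed.

Lemma measurable_step_avg n z : measurable_fun setT
  (fun om : env_seq R => step_avg w (hit_prob w eps n om) z).
Proof.
apply: measurableT_comp => //; apply: measurable_nneseries => [j om|j].
  by rewrite lee_fin mulr_ge0//; case/andP: (h01 n om (z + j)%N).
by apply/measurable_EFinP; apply: measurable_funM => //; exact: measurable_hit_prob.
Qed.

Lemma integral_step_avg n z :
  \int[PE]_e (step_avg w (hit_prob w eps n (env_from F 0 e)) z)%:E =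
  (step_avg w (annealed_hit n) z)%:E.
Proof.
rewrite step_avgE//; last by move=> z'; exact: annealed_hit_itv.
under eq_integral do rewrite step_avgE//.
have ge j e : (0 <= w j * hit_prob w eps n (env_from F 0 e) (z + j)%N)%R.
  by rewrite mulr_ge0//; case/andP: (h01 n (env_from F 0 e) (z + j)%N).
rewrite integral_nneseries//; first last.
- by move=> j e _; rewrite lee_fin.
- move=> j; apply/measurable_EFinP; apply: measurable_funM => //.
  exact: measurable_hit_prob_env.
apply: eq_eseriesr => j _; under eq_integral do rewrite EFinM.
rewrite ge0_integralZl_EFin//.
- by rewrite EFinM annealed_hitE.
- by move=> e _; rewrite lee_fin; case/andP: (h01 n (env_from F 0 e) (z + j)%N).
- exact/measurable_EFinP/measurable_hit_prob_env.
Qed.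

Lemma hit_prob_succ n z e : hit_prob w eps n.+1 (env_from F 0 e) z.+1 =
  survival (F 1 e) (step_avg w (hit_prob w eps n (env_from F 1 e)) z).
Proof. by []. Qed.

Lemma integral_first_avg (a : law R -> \bar R) (phi : R -> R) n z :
  measurable_fun setT a -> (forall G, 0 <= a G) ->
  measurable_fun setT phi -> (forall x, (0 <= phi x)%R) ->
  \int[PE]_e (a (F 1 e) * (phi (step_avg w (hit_prob w eps n (env_from F 1 e)) z))%:E) =
  (\int[PE]_e a (F 1 e)) *
  \int[PE]_e (phi (step_avg w (hit_prob w eps n (env_from F 0 e)) z))%:E.
Proof.
move=> ma a0 mphi phi0.
apply: (integral_first_env iidF (b := fun om =>
  (phi (step_avg w (hit_prob w eps n om) z))%:E)) => //.
  by apply/measurable_EFinP; apply: (measurableT_comp mphi); exact: measurable_step_avg.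
by move=> om; rewrite lee_fin.
Qed.

Lemma integral_first_step (a : law R -> \bar R) n z :
  measurable_fun setT a -> (forall G, 0 <= a G) ->
  \int[PE]_e (a (F 1 e) * (step_avg w (hit_prob w eps n (env_from F 1 e)) z)%:E) =
  (\int[PE]_e a (F 1 e)) * (step_avg w (annealed_hit n) z)%:E.
Proof.
move=> ma a0.
rewrite -(integral_step_avg n z).
apply: (integral_first_env iidF (b := fun om =>
  (step_avg w (hit_prob w eps n om) z)%:E)) => //.
  by apply/measurable_EFinP; exact: measurable_step_avg.
by move=> om; rewrite lee_fin; case/andP: (avg01 n om z).
Qed.

Let mmean : measurable_fun setT (fun e => mean (F 1 e)).
Proof. by apply: (measurableT_comp (@measurable_mean R)); have [H _ _] := iidF. Qed.

Let mavg n z k : measurable_fun setT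
  (fun e => step_avg w (hit_prob w eps n (env_from F k e)) z).
Proof. exact: (measurableT_comp (measurable_step_avg n z) (measurable_env_from iidF k)). Qed.

Variable r : R.
Hypothesis mean_r : \int[PE]_e mean (F 1 e) = r%:E.

Lemma annealed_hit_succ_le n z :
  (annealed_hit n.+1 z.+1 <= r * step_avg w (annealed_hit n) z)%R.
Proof.
rewrite -lee_fin EFinM -mean_r -(integral_first_step n z (@measurable_mean R) (@mean_ge0 R)).
rewrite annealed_hitE; apply: ge0_le_integral => //.
- by move=> e _; rewrite lee_fin; case/andP: (h01 n.+1 (env_from F 0 e) z.+1).
- exact/measurable_EFinP/measurable_hit_prob_env.
- by apply: emeasurable_funM => //; apply/measurable_EFinP; exact: mavg.
- by move=> e _; rewrite hit_prob_succ; exact: survival_le_mean.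
Qed.

Variables (lam : R).
Hypothesis r_gt0 : (0 < r)%R.
Hypothesis lam_r : \sum_(j <oo) (w j * expR (lam * (1 - j%:R)))%:E = (r^-1)%:E.

(** The expected number of particles that first climb [z] levels is
    [expR (- lam * z)], by the choice of [lam]; this is the union bound over
    these particles.  In the induction, [expR (- lam * z)] is harmonic for one
    step of the walk multiplied by the mean offspring number [r]. *)
Lemma annealed_hit_decay n x z :
  (annealed_hit n (z + x) <= expR (- lam * z%:R) * annealed_hit n x)%R.
Proof.
elim: n z => [|n IH] [|z]; do ?by rewrite mulr0 expR0 mul1r.
  have -> : annealed_hit 0 (z.+1 + x) = 0%R.
    apply: EFin_inj; rewrite annealed_hitE.
    by rewrite (_ : (fun e => _) = cst 0%:E) ?integral0//; apply/funext.
  by rewrite mulr_ge0 ?expR_ge0//; case/andP: (annealed_hit_itv 0 x).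
have px0 : (0 <= annealed_hit n x)%R by case/andP: (annealed_hit_itv n x).
apply: (le_trans (annealed_hit_succ_le _ _)).
have := @step_avg_le_exp _ w w_ge0 w_le1 (annealed_hit n) (z + x) lam r^-1 (annealed_hit n x) z%:R
  (annealed_hit_itv n) px0 lam_r.
move=> /(_ _)/(ler_wpM2l (ltW r_gt0)) H; apply: (le_trans (H _)).
  by move=> j; rewrite addnAC -natrD mulrC; exact: IH.
rewrite mulrCA -mulrA mulfV ?gt_eqF// mulr1 mulrC -natr1 ler_wpM2l ?expR_ge0//.
exact: le_annealed_hit_time.
Qed.

Variables (th kap rth Mth : R).
Hypothesis th01 : (0 < th <= 1)%R.
Hypothesis mean_rth : \int[PE]_e (poweR (mean (F 1 e)) (1 + th)) = rth%:E.
Hypothesis kap_Mth : \sum_(j <oo) (w j * expR ((kap - lam * th) * (1 - j%:R)))%:E = Mth%:E.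
Hypothesis subcritical : (rth * (r^-1 `^ th) * Mth <= 1)%R.

Let rth0 : (0 <= rth)%R.
Proof. by rewrite -lee_fin -mean_rth; apply: integral_ge0 => e _; exact: poweR_ge0. Qed.

Let th0 : (0 < th)%R. Proof. by case/andP: th01. Qed.

Definition moment_hit n z :=
  \int[PE]_e ((hit_prob w eps n (env_from F 0 e) z) `^ (1 + th))%:E.

Lemma moment_step_avg n z :
  (forall z, moment_hit n z <= (eps `^ (1 + th) * expR (- kap * z%:R))%:E) ->
  \int[PE]_e ((step_avg w (hit_prob w eps n (env_from F 0 e)) z) `^ (1 + th))%:E <=
  (eps `^ (1 + th) * (r^-1 `^ th * Mth) * expR (- kap * z.+1%:R))%:E.
Proof.
move=> IH.
have ri0 : (0 < r^-1)%R by rewrite invr_gt0.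
have mh j k : measurable_fun setT (fun e =>
    (w j * expR (- (lam * th) * (1 - j%:R)) * hit_prob w eps n (env_from F 0 e) k `^ (1 + th))%:E).
  apply/measurable_EFinP; apply: measurable_funM => //.
  apply: (measurableT_comp (measurable_powR (1 + th)%R)).
  exact: measurable_hit_prob_env.
have ge j k e : 0 <= (w j * expR (- (lam * th) * (1 - j%:R)) *
    hit_prob w eps n (env_from F 0 e) k `^ (1 + th))%:E.
  by rewrite lee_fin !mulr_ge0 ?expR_ge0 ?powR_ge0.
apply: (@le_trans _ _ (\int[PE]_e ((r^-1 `^ th)%:E * \sum_(j <oo)
   (w j * expR (- (lam * th) * (1 - j%:R)) * hit_prob w eps n (env_from F 0 e) (z + j)%N `^ (1 + th))%:E))).
  apply: ge0_le_integral => //.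
  - by move=> e _; rewrite lee_fin powR_ge0.
  - apply/measurable_EFinP; apply: (measurableT_comp (measurable_powR (1 + th)%R)).
    exact: mavg.
  - apply: measurable_funeM; apply: measurable_nneseries => [j e|j]; first exact: ge.
    exact: mh.
  - by move=> e _; exact: step_avg_powR.
rewrite ge0_integralZl_EFin ?powR_ge0//; first last.
- by apply: measurable_nneseries => [j e|j]; [exact: ge|exact: mh].
- by move=> e _; apply: nneseries_ge0 => j _ _; exact: ge.
rewrite integral_nneseries//.
apply: (@le_trans _ _ ((r^-1 `^ th)%:E * ((eps `^ (1 + th) * expR (- kap * z.+1%:R))%:E *
    \sum_(j <oo) (w j * expR ((kap - lam * th) * (1 - j%:R)))%:E))); last first.
  by rewrite kap_Mth -!EFinM lee_fin le_eqVlt; apply/orP; left; apply/eqP; ring.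
apply: lee_wpmul2l; first by rewrite lee_fin powR_ge0.
rewrite -nneseriesZl; last by move=> j _; rewrite lee_fin mulr_ge0 ?expR_ge0.
apply: lee_nneseries => j.
  by move=> _ _; apply: integral_ge0 => e _; exact: ge.
move=> _; under eq_integral do rewrite EFinM.
rewrite ge0_integralZl_EFin//; first last.
- by rewrite mulr_ge0 ?expR_ge0.
- apply/measurable_EFinP; apply: (measurableT_comp (measurable_powR (1 + th)%R)).
  exact: measurable_hit_prob_env.
- by move=> e _; rewrite lee_fin powR_ge0.
apply: (le_trans (lee_wpmul2l _ (IH (z + j)%N))).
  by rewrite lee_fin mulr_ge0 ?expR_ge0.
rewrite -!EFinM lee_fin natrD -natr1 le_eqVlt; apply/orP; left; apply/eqP.
have XY : (expR (- (lam * th) * (1 - j%:R)) * expR (- kap * (z%:R + j%:R)) =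
    expR (- kap * (z%:R + 1)) * expR ((kap - lam * th) * (1 - j%:R)))%R.
  by rewrite -!expRD; congr expR; ring.
rewrite [RHS](_ : _ = eps `^ (1 + th) * w j * (expR (- kap * (z%:R + 1)) *
  expR ((kap - lam * th) * (1 - j%:R))))%R; last ring.
by rewrite -XY; ring.
Qed.

(** [expR (- kap * z)] is superharmonic for the step operator that Hölder's
    inequality produces for moments of order [1 + th]; this is [subcritical]. *)
Lemma moment_hit_decay n z :
  moment_hit n z <= (eps `^ (1 + th) * expR (- kap * z%:R))%:E.
Proof.
have e0 : (0 <= eps)%R by case/andP: eps01.
elim: n z => [|n IH] [|z].
- rewrite /moment_hit /= integral_const mulr0 expR0 mulr1.
  by [].
- rewrite /moment_hit /= powR0 ?gt_eqF ?addr_gt0// integral0.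
  by rewrite lee_fin mulr_ge0 ?expR_ge0 ?powR_ge0.
- rewrite /moment_hit /= integral_const mulr0 expR0 mulr1.
  by [].
have p0 : (0 < 1 + th)%R by rewrite addr_gt0.
have mpow : measurable_fun setT (fun x : R => (x `^ (1 + th))%R) by exact: measurable_powR.
have mpm : measurable_fun setT (fun G : law R => poweR (mean G) (1 + th)).
  exact: (measurableT_comp (measurable_poweR (1 + th)%R) (@measurable_mean R)).
apply: (@le_trans _ _ (\int[PE]_e (poweR (mean (F 1 e)) (1 + th) *
  ((step_avg w (hit_prob w eps n (env_from F 1 e)) z) `^ (1 + th))%:E))).
  apply: ge0_le_integral => //.
  - by move=> e _; rewrite lee_fin powR_ge0.
  - apply/measurable_EFinP; apply: (measurableT_comp (measurable_powR (1 + th)%R)).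
    exact: measurable_hit_prob_env.
  - apply: emeasurable_funM; last first.
      by apply/measurable_EFinP; apply: (measurableT_comp mpow); exact: mavg.
    exact: (measurableT_comp (measurable_poweR (1 + th)%R)).
  - move=> e _; rewrite hit_prob_succ.
    set s := step_avg _ _ _; have s01 : (0 <= s <= 1)%R := avg01 n _ z.
    rewrite -!poweR_EFin -poweRM ?mean_ge0//; last by rewrite lee_fin; case/andP: s01.
    have ms0 : 0 <= mean (F 1 e) * s%:E.
      by rewrite mule_ge0 ?mean_ge0// lee_fin; case/andP: s01.
    apply: gt0_ler_poweR; [exact: ltW| | |exact: survival_le_mean].
      by rewrite in_itv/= leey andbT lee_fin survival_ge0.
    by rewrite in_itv/= leey andbT.
have -> := integral_first_avg n z mpm (fun G => poweR_ge0 _ _) mpow (fun x => powR_ge0 _ _).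
rewrite mean_rth; apply: (le_trans (lee_wpmul2l _ (moment_step_avg _ IH))); first by rewrite lee_fin.
rewrite -EFinM lee_fin.
have -> : (rth * (eps `^ (1 + th) * (r^-1 `^ th * Mth) * expR (- kap * z.+1%:R)) =
  (eps `^ (1 + th) * expR (- kap * z.+1%:R)) * (rth * r^-1 `^ th * Mth))%R by ring.
by rewrite ler_piMr// mulr_ge0 ?powR_ge0 ?expR_ge0.
Qed.

(** The mean offspring number restricted to the laws whose normalized second
    factorial moment exceeds [L]. *)
Definition trunc_mean (L : R) : \bar R := \int[PE]_e
  (if second_factorial_moment (F 1 e) <= L%:E * (mean (F 1 e) * mean (F 1 e))
   then 0 else mean (F 1 e)).

Lemma annealed_hit_succ_ge n z (L psi : R) : (0 < L)%R -> trunc_mean L = psi%:E ->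
  (r * step_avg w (annealed_hit n) z <= annealed_hit n.+1 z.+1
   + psi * step_avg w (annealed_hit n) z
   + L `^ th * (eps `^ (1 + th) * expR (- kap * z.+1%:R)))%R.
Proof.
move=> L0 psiE.
have e0 : (0 <= eps)%R by case/andP: eps01.
have p0 : (0 < 1 + th)%R by rewrite addr_gt0.
have mpow : measurable_fun setT (fun x : R => (x `^ (1 + th))%R) by exact: measurable_powR.
have mpm : measurable_fun setT (fun G : law R => poweR (mean G) (1 + th)).
  exact: (measurableT_comp (measurable_poweR (1 + th)%R) (@measurable_mean R)).
pose a (G : law R) := if second_factorial_moment G <= L%:E * (mean G * mean G)
   then 0 else mean G.
have a0 G : 0 <= a G by rewrite /a; case: ifP => // _; exact: mean_ge0.
have ma : measurable_fun setT a.
  apply: measurable_fun_ifT => //; last exact: measurable_mean.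
  apply: measurable_fun_lee; first exact: measurable_second_factorial_moment.
  by apply: measurable_funeM; apply: emeasurable_funM; exact: measurable_mean.
pose s e := step_avg w (hit_prob w eps n (env_from F 1 e)) z.
have ms : measurable_fun setT s by exact: mavg.
have s01 e : (0 <= s e <= 1)%R := avg01 n _ z.
have s0 e : (0 <= s e)%R by case/andP: (s01 e).
have mF1 : measurable_fun setT (F 1) by have [H _ _] := iidF.
have I1 := integral_first_step n z (@measurable_mean R) (@mean_ge0 R).
have I2 := integral_first_step n z ma a0.
have I3 := integral_first_avg n z mpm (fun G => poweR_ge0 _ _) mpow (fun x => powR_ge0 _ _).
have psi_int : \int[PE]_e a (F 1 e) = psi%:E by rewrite -psiE.
have f1 e : 0 <= (hit_prob w eps n.+1 (env_from F 0 e) z.+1)%:E.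
  by rewrite lee_fin; case/andP: (h01 n.+1 (env_from F 0 e) z.+1).
have f2 e : 0 <= a (F 1 e) * (s e)%:E by rewrite mule_ge0 ?lee_fin.
have f3 e : 0 <= poweR (mean (F 1 e)) (1 + th) * ((s e) `^ (1 + th))%:E.
  by rewrite mule_ge0 ?poweR_ge0// lee_fin powR_ge0.
have mf1 : measurable_fun setT (fun e => (hit_prob w eps n.+1 (env_from F 0 e) z.+1)%:E).
  exact/measurable_EFinP/measurable_hit_prob_env.
have mf2 : measurable_fun setT (fun e => a (F 1 e) * (s e)%:E).
  by apply: emeasurable_funM; [exact: (measurableT_comp ma)|exact/measurable_EFinP].
have mf3 : measurable_fun setT
    (fun e => poweR (mean (F 1 e)) (1 + th) * ((s e) `^ (1 + th))%:E).
  apply: emeasurable_funM; first exact: (measurableT_comp mpm).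
  by apply/measurable_EFinP; exact: (measurableT_comp mpow).
rewrite -lee_fin EFinM -mean_r -I1.
apply: (@le_trans _ _ (\int[PE]_e ((hit_prob w eps n.+1 (env_from F 0 e) z.+1)%:E
   + a (F 1 e) * (s e)%:E
   + (L `^ th)%:E * (poweR (mean (F 1 e)) (1 + th) * ((s e) `^ (1 + th))%:E)))).
  apply: ge0_le_integral => //.
  - by move=> e _; rewrite mule_ge0 ?mean_ge0// lee_fin; exact: (s0 e).
  - by apply: emeasurable_funM => //; apply/measurable_EFinP.
  - by apply: emeasurable_funD; [exact: emeasurable_funD|exact: measurable_funeM].
  - move=> e _; rewrite hit_prob_succ.
    have -> : a (F 1 e) * (s e)%:E =
      (if second_factorial_moment (F 1 e) <= L%:E * (mean (F 1 e) * mean (F 1 e))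
       then 0 else mean (F 1 e) * (s e)%:E).
      by rewrite /a; case: ifP => // _; rewrite mul0e.
    exact: mean_le_survival_trunc.
rewrite ge0_integralD//; first last.
- exact: measurable_funeM.
- by move=> e _; rewrite mule_ge0// lee_fin powR_ge0.
- exact: emeasurable_funD.
- by move=> e _; exact: adde_ge0.
rewrite ge0_integralD// ge0_integralZl_EFin ?powR_ge0// I2 I3 psi_int -annealed_hitE mean_rth.
rewrite !EFinD EFinM leeD2l// EFinM lee_wpmul2l ?lee_fin ?powR_ge0//.
apply: (le_trans (lee_wpmul2l _ (moment_step_avg _ (moment_hit_decay n)))); first by rewrite lee_fin.
rewrite -EFinM lee_fin.
have -> : (rth * (eps `^ (1 + th) * (r^-1 `^ th * Mth) * expR (- kap * z.+1%:R)) =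
  (eps `^ (1 + th) * expR (- kap * z.+1%:R)) * (rth * r^-1 `^ th * Mth))%R by ring.
by rewrite ler_piMr// mulr_ge0 ?powR_ge0 ?expR_ge0.
Qed.

End annealed_recursion.

(** * A barrier for walks with positive drift *)

Section barrier.
Context (R : realType).
Variables (err : nat -> R) (v : R).
Hypothesis v0 : 0 < v.
Hypothesis err_ge0 : forall z, 0 <= err z.
Hypothesis err_noninc : forall z, err z.+1 <= err z.
Hypothesis err_sum : (\sum_(z <oo) (err z)%:E <= (v / 2)%:E)%E.

Definition barrier (z : nat) : R := fine (\sum_(z <= i <oo) (err i)%:E)%E / v.

Let tail_ge0 z : (0 <= \sum_(z <= i <oo) (err i)%:E)%E.
Proof. by apply: nneseries_ge0 => i _ _; rewrite lee_fin. Qed.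

Let tail_le z : (\sum_(z <= i <oo) (err i)%:E <= (v / 2)%:E)%E.
Proof.
apply: le_trans err_sum; rewrite [leRHS](@nneseries_split _ _ 0 z)//=; last first.
  by move=> i _; rewrite lee_fin.
by rewrite add0n leeDr// sume_ge0// => i _; rewrite lee_fin.
Qed.

Let tail_fin z : (\sum_(z <= i <oo) (err i)%:E)%E \is a fin_num.
Proof. by rewrite ge0_fin_numE//; apply: le_lt_trans (tail_le z) (ltry _). Qed.

Lemma barrier_itv z : 0 <= barrier z <= 1 / 2.
Proof.
rewrite /barrier divr_ge0 ?fine_ge0 ?(ltW v0)//=.
rewrite ler_pdivrMr// -lee_fin fineK//; apply: le_trans (tail_le z) _.
by rewrite lee_fin; lra.
Qed.

Lemma barrier_succ z : barrier z = barrier z.+1 + err z / v.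
Proof.
rewrite /barrier -mulrDl; congr (_ / _).
rewrite (@nneseries_split _ _ z 1); last by move=> i _; rewrite lee_fin.
by rewrite addn1 big_nat1 fineD// addrC.
Qed.

Lemma le_err z j : err (z + j) <= err z.
Proof.
elim: j => [|j IH]; first by rewrite addn0.
by rewrite addnS; apply: le_trans IH.
Qed.

(** The barrier is convex with increment [err z / v]: its mean along a step
    [1 - j] of drift at least [v] increases by at least [err z]. *)
Lemma barrier_step z j :
  barrier z.+1 + err z / v <= barrier (z + j) + j%:R * (err z / v).
Proof.
elim: j => [|j IH]; first by rewrite addn0 mul0r addr0 -barrier_succ.
apply: (le_trans IH); rewrite [barrier (z + j)]barrier_succ addnS -natr1 mulrDl mul1r.
have : err (z + j) / v <= err z / v by rewrite ler_pM2r ?invr_gt0// le_err.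
lra.
Qed.

Variables (w : nat -> R) (lam r eps : R) (P : nat -> nat -> R).
Hypothesis w_ge0 : forall j, 0 <= w j.
Hypothesis w_le1 : (\sum_(j <oo) (w j)%:E <= 1)%E.
Hypothesis lam0 : 0 < lam.
Hypothesis r0 : 0 < r.
Hypothesis lam_r : (\sum_(j <oo) (w j * expR (lam * (1 - j%:R)))%:E = (r^-1)%:E)%E.
Hypothesis drift :
  (\sum_(j <oo) (w j * expR (lam * (1 - j%:R)) * j%:R)%:E <= ((1 - v) / r)%:E)%E.
Hypothesis eps0 : 0 < eps.
Hypothesis P01 : forall n z, 0 <= P n z <= 1.
Hypothesis P0 : forall n, P n 0%N = eps.
Hypothesis Pstep : forall n z, r * step_avg w (P n) z <=
  P n.+1 z.+1 + eps * expR (- lam * z.+1%:R) * err z.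

(** [expR (- lam * z) * (1 / 2 + barrier z)] is subharmonic with a margin that
    pays for the errors in [Pstep].  At time 0 it may exceed [P] away from the
    target; the term [eps * r ^+ n] covers this, since a constant is multiplied
    by at most [r] in each step. *)
Lemma barrier_lower n z :
  eps * expR (- lam * z%:R) * (1 / 2 + barrier z) <= P n z + eps * r ^+ n.
Proof.
have base z' : 1 / 2 + barrier z' <= 1 by have /andP[_ ?] := barrier_itv z'; lra.
have baseg z' : 0 <= 1 / 2 + barrier z' by have /andP[? _] := barrier_itv z'; lra.
have atom m : eps * expR (- lam * 0%:R) * (1 / 2 + barrier 0) <= P m 0%N + eps * r ^+ m.
  rewrite P0 mulr0 expR0 mulr1; apply: (@le_trans _ _ (eps * 1)).
    by rewrite ler_wpM2l ?(ltW eps0).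
  by rewrite mulr1 lerDl mulr_ge0 ?exprn_ge0 ?(ltW r0) ?(ltW eps0).
elim: n z => [|n IH] [|z]; do ?exact: atom.
  rewrite expr0 mulr1; apply: (@le_trans _ _ (eps * 1)); last first.
    by rewrite mulr1 lerDr; case/andP: (P01 0 z.+1).
  rewrite -mulrA ler_wpM2l ?(ltW eps0)// mulr_ile1 ?expR_ge0//.
  by rewrite -expR0 ler_expR mulNr oppr_le0 mulr_ge0 ?(ltW lam0).
set A := eps * expR (- lam * z.+1%:R).
have A0 : 0 <= A by rewrite mulr_ge0 ?expR_ge0 ?(ltW eps0).
have ev0 : 0 <= err z / v by rewrite divr_ge0 ?(ltW v0).
have rn0 : 0 <= eps * r ^+ n by rewrite mulr_ge0 ?exprn_ge0 ?(ltW r0) ?(ltW eps0).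
have key : ((A * (1 / 2 + barrier z.+1 + err z / v) / r)%:E <=
   (step_avg w (P n) z + eps * r ^+ n + A * (err z / v) * ((1 - v) / r))%:E)%E.
  have ge1 j : 0 <= w j * expR (lam * (1 - j%:R)) by rewrite mulr_ge0 ?expR_ge0.
  have geP j : 0 <= P n (z + j)%N by case/andP: (P01 n (z + j)%N).
  rewrite EFinM -lam_r -nneseriesZl; last by move=> j _; rewrite lee_fin.
  apply: (@le_trans _ _ (\sum_(j <oo) ((w j * P n (z + j)%N)%:E +
      (eps * r ^+ n)%:E * (w j)%:E + (A * (err z / v))%:E *
      (w j * expR (lam * (1 - j%:R)) * j%:R)%:E))%E).
    apply: lee_nneseries => j.
      move=> _ _; rewrite -EFinM lee_fin mulr_ge0// mulr_ge0// addr_ge0//.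
    move=> _; rewrite -!EFinM -!EFinD lee_fin.
    set u := expR (lam * (1 - j%:R)).
    have Au : A * u = eps * expR (- lam * (z + j)%:R).
      rewrite /A /u -mulrA -expRD; congr (_ * expR _).
      by rewrite natrD -natr1; ring.
    have := barrier_step z j; have := IH (z + j)%N; rewrite -Au => H1 H2.
    have wj := w_ge0 j; have u0 : 0 < u by exact: expR_gt0.
    have H3 : A * u * (1 / 2 + barrier z.+1 + err z / v) <=
       A * u * (1 / 2 + barrier (z + j)%N + j%:R * (err z / v)).
      apply: ler_wpM2l; first by apply: mulr_ge0 => //; exact: ltW.
      by move: H2; rewrite -!addrA lerD2l.
    have H4 : A * u * (1 / 2 + barrier z.+1 + err z / v) <=
       P n (z + j)%N + eps * r ^+ n + A * u * (j%:R * (err z / v)).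
      by move: H3; rewrite [X in _ <= X -> _]mulrDr; lra.
    by have := ler_wpM2l wj H4; lra.
  rewrite nneseriesD; first last.
  - by move=> j _ _; rewrite -EFinM lee_fin; apply: mulr_ge0; exact: mulr_ge0.
  - by move=> j _ _; rewrite -EFinM -EFinD lee_fin; apply: addr_ge0; exact: mulr_ge0.
  rewrite nneseriesD; first last.
  - by move=> j _ _; rewrite -EFinM lee_fin mulr_ge0.
  - by move=> j _ _; rewrite lee_fin mulr_ge0.
  rewrite !EFinD -step_avgE//; apply: leeD.
    rewrite nneseriesZl; last by move=> j _; rewrite lee_fin.
    by rewrite leeD2l// -[leRHS]mule1 lee_wpmul2l// lee_fin.
  rewrite nneseriesZl; last by move=> j _; rewrite lee_fin mulr_ge0.
  by rewrite [leRHS]EFinM lee_wpmul2l// lee_fin mulr_ge0.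
have := Pstep n z; rewrite -/A; move: key; rewrite lee_fin.
move=> /(ler_wpM2l (ltW r0)).
have -> : r * (A * (1 / 2 + barrier z.+1 + err z / v) / r) =
  A * (1 / 2 + barrier z.+1 + err z / v) by field; rewrite (gt_eqF r0) (gt_eqF v0).
have -> : r * (step_avg w (P n) z + eps * r ^+ n + A * (err z / v) * ((1 - v) / r)) =
  r * step_avg w (P n) z + eps * r ^+ n.+1 + A * (err z / v) - A * err z.
  by rewrite exprS; field; rewrite (gt_eqF r0) (gt_eqF v0).
lra.
Qed.

End barrier.

(** * The lower bound for the annealed hitting probabilities *)

Section annealed_lower_bound.
Context d (E : measurableType d) (R : realType).
Variables (PE : probability E R) (F : int -> E -> law R).
Hypothesis iidF : iid_environment PE F.
Variable w : nat -> R.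
Hypothesis w_ge0 : forall j, 0 <= w j.
Hypothesis w_le1 : (\sum_(j <oo) (w j)%:E <= 1)%E.

Lemma le_annealed_hit_eps eps n z : 0 <= eps <= 1 ->
  annealed_hit PE F w eps n z <= annealed_hit PE F w 1 n z.
Proof.
move=> /andP[e0 e1]; have e01 : 0 <= eps <= 1 by rewrite e0.
have o01 : 0 <= (1 : R) <= 1 by rewrite ler01 lexx.
rewrite -lee_fin !annealed_hitE//; apply: ge0_le_integral => //.
- by move=> e _; rewrite lee_fin; case/andP: (hit_prob_itv w_ge0 w_le1 n (env_from F 0 e) z e01).
- by apply/measurable_EFinP; exact: (measurable_hit_prob_env iidF w_ge0 w_le1 e01 n z 0).
- by apply/measurable_EFinP; exact: (measurable_hit_prob_env iidF w_ge0 w_le1 o01 n z 0).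
- by move=> e _; rewrite lee_fin; exact: le_hit_prob_eps.
Qed.

Variables (lam r v th del rth Mth : R).
Hypothesis lam0 : 0 < lam.
Hypothesis r0 : 0 < r.
Hypothesis v0 : 0 < v.
Hypothesis th01 : 0 < th <= 1.
Hypothesis del0 : 0 < del.
Hypothesis mean_r : (\int[PE]_e mean (F 1 e) = r%:E)%E.
Hypothesis lam_r : (\sum_(j <oo) (w j * expR (lam * (1 - j%:R)))%:E = (r^-1)%:E)%E.
Hypothesis drift :
  (\sum_(j <oo) (w j * expR (lam * (1 - j%:R)) * j%:R)%:E <= ((1 - v) / r)%:E)%E.
Hypothesis mean_rth : (\int[PE]_e (poweR (mean (F 1 e)) (1 + th)) = rth%:E)%E.
Hypothesis kap_Mth : (\sum_(j <oo)
  (w j * expR ((lam + del * th - lam * th) * (1 - j%:R)))%:E = Mth%:E)%E.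
Hypothesis subcritical : rth * (r^-1 `^ th) * Mth <= 1.
Let psi (z : nat) := trunc_mean PE F (expR (del / 2 * z%:R)).
Hypothesis psi_sum : (\sum_(z <oo) psi z < +oo)%E.

Let psi_ge0 z : (0 <= psi z)%E.
Proof. by apply: integral_ge0 => e _; case: ifP => // _; exact: mean_ge0. Qed.

Let psi_fin z : psi z \is a fin_num.
Proof.
rewrite ge0_fin_numE//; apply: le_lt_trans psi_sum.
rewrite (@nneseriesD1 _ _ z)//.
by rewrite leeDl//; apply: nneseries_ge0.
Qed.

Let psi_noninc z : (psi z.+1 <= psi z)%E.
Proof.
have mF1 : measurable_fun setT (F 1) by have [H _ _] := iidF.
have ma L : measurable_fun setT (fun e => if (second_factorial_moment (F 1%R e) <=
    L%:E * (mean (F 1%R e) * mean (F 1%R e)))%E then 0%E else mean (F 1%R e)).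
  apply: (@measurableT_comp _ _ _ _ _ _ (fun G : law R => if (second_factorial_moment G <=
    L%:E * (mean G * mean G))%E then 0%E else mean G) _ (F 1)) => //.
  apply: measurable_fun_ifT => //; last exact: measurable_mean.
  apply: measurable_fun_lee; first exact: measurable_second_factorial_moment.
  by apply: measurable_funeM; apply: emeasurable_funM; exact: measurable_mean.
apply: ge0_le_integral => //.
  by move=> e _; case: ifP => // _; exact: mean_ge0.
move=> e _; case: ifPn => [_|H]; first by case: ifP => // _; exact: mean_ge0.
rewrite ifN//; apply: contra H => /le_trans; apply.
apply: lee_wpmul2r; first by rewrite mule_ge0 ?mean_ge0.
by rewrite lee_fin ler_expR ler_wpM2l ?divr_ge0 ?(ltW del0)// ler_nat.
Qed.

(** The two parts of the error are made small in turn: the shift [k0] of the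
    truncation level takes a tail of the series of truncated means, and then
    [eps] beats the factor [K] that this shift costs in the other part. *)
Lemma annealed_lower : exists2 eps, 0 < eps <= 1 & forall n z,
  eps * expR (- lam * z%:R) * (1 / 2) <= annealed_hit PE F w eps n z + eps * r ^+ n.
Proof.
have /andP[th0 th1] := th01.
have [k0 Hk0] : exists k0, (\sum_(k0 <= z <oo) psi z <= (r * (v / 4))%:E)%E.
  have /fine_cvgP[_ /cvgrPdist_le] := @nneseries_tail_cvg _ psi xpredT psi_sum (fun z _ => psi_ge0 z).
  have rv0 : 0 < r * (v / 4) by rewrite !mulr_gt0 ?invr_gt0.
  move=> /(_ _ rv0)[k0 _ /(_ k0 (leqnn _))] /= H; exists k0.
  have ge : (0 <= \sum_(k0 <= z <oo) psi z)%E by apply: nneseries_ge0.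
  have fin : (\sum_(k0 <= z <oo) psi z)%E \is a fin_num.
    rewrite ge0_fin_numE//; apply: le_lt_trans psi_sum.
    rewrite [leRHS](@nneseries_split _ _ 0 k0)//= add0n leeDr// sume_ge0//.
  rewrite -(fineK fin) lee_fin; apply: le_trans H.
  by rewrite sub0r normrN ler_norm.
pose K := expR (th * (del / 2) * k0%:R).
pose q := expR (- (th * (del / 2))).
have q01 : 0 < q < 1.
  by rewrite expR_gt0/= -expR0 ltr_expR oppr_lt0 !mulr_gt0 ?invr_gt0.
have /andP[q0 q1] := q01.
(* with this bound on [eps `^ th] the geometric part sums to at most [v / 4] *)
pose e1 := v * (1 - q) / (4 * K).
have K0 : 0 < K by exact: expR_gt0.
have e10 : 0 < e1 by rewrite divr_gt0 ?mulr_gt0 ?subr_gt0.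
pose eps := Num.min 1 (e1 `^ th^-1).
have eps0 : 0 < eps by rewrite lt_min ltr01 powR_gt0.
have eps1 : eps <= 1 by rewrite ge_min lexx.
have eps01 : 0 <= eps <= 1 by rewrite eps1 ltW.
have epsth : eps `^ th <= e1.
  apply: (@le_trans _ _ ((e1 `^ th^-1) `^ th)).
    by rewrite ge0_ler_powR ?nnegrE ?powR_ge0 ?(ltW eps0) ?(ltW th0)// ge_min lexx orbT.
  by rewrite -powRrM mulVf ?gt_eqF// powRr1// ltW.
exists eps; first by rewrite eps0.
pose P := annealed_hit PE F w eps.
pose err z := fine (psi (z + k0)%N) / r + eps `^ th * K * q ^+ z.
have err0 z : 0 <= err z.
  apply: addr_ge0; first by rewrite divr_ge0 ?fine_ge0 ?(ltW r0).
  by rewrite !mulr_ge0 ?powR_ge0 ?exprn_ge0 ?(ltW K0) ?(ltW q0).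
have err_noninc z : err z.+1 <= err z.
  apply: lerD; first by rewrite ler_pM2r ?invr_gt0// addSn fine_le.
  rewrite ler_wpM2l ?mulr_ge0 ?powR_ge0 ?(ltW K0)//.
  by rewrite exprS ler_piMl ?exprn_ge0 ?ltW.
have err_sum : (\sum_(z <oo) (err z)%:E <= (v / 2)%:E)%E.
  under eq_eseriesr do rewrite /err EFinD.
  rewrite nneseriesD; first last.
  - by move=> z _ _; rewrite lee_fin !mulr_ge0 ?powR_ge0 ?exprn_ge0 ?(ltW K0) ?(ltW q0).
  - by move=> z _ _; rewrite lee_fin divr_ge0 ?fine_ge0 ?(ltW r0).
  rewrite (_ : v / 2 = v / 4 + v / 4); last by field.
  rewrite EFinD; apply: leeD.
    under eq_eseriesr do rewrite mulrC EFinM fineK//.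
    rewrite nneseriesZl//; rewrite (nneseries_addn _ psi_ge0).
    apply: (le_trans (lee_wpmul2l _ Hk0)); first by rewrite lee_fin invr_ge0 ltW.
    by rewrite -EFinM mulKf ?gt_eqF.
  under eq_eseriesr do rewrite EFinM.
  rewrite nneseriesZl; last by move=> z _; rewrite lee_fin exprn_ge0 ?ltW.
  have geo : (\sum_(z <oo) (q ^+ z)%:E <= ((1 - q)^-1)%:E)%E.
    apply: lime_le; first by apply: is_cvg_nneseries => z _ _; rewrite lee_fin exprn_ge0 ?ltW.
    apply: nearW => n; rewrite sumEFin lee_fin.
    have := @geometric_seriesE R 1 q; rewrite lt_eqF// => /(_ isT)/(congr1 (@^~ n)).
    rewrite /series/= mul1r => H; rewrite (_ : \sum_(0 <= i < n) q ^+ i = (1 - q ^+ n) / (1 - q)).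
      by rewrite ler_piMl ?invr_ge0 ?subr_ge0 ?(ltW q1)// gerBl exprn_ge0 ?ltW.
    by rewrite -H; apply: eq_bigr => i _; rewrite mul1r.
  have eK0 : 0 <= eps `^ th * K by rewrite mulr_ge0 ?powR_ge0 ?ltW.
  apply: (le_trans (lee_wpmul2l _ geo)); first by rewrite lee_fin.
  rewrite -EFinM lee_fin ler_pdivrMr ?subr_gt0//.
  apply: (le_trans (ler_wpM2r (ltW K0) epsth)).
  rewrite le_eqVlt; apply/orP; left; apply/eqP; rewrite /e1; field.
  by rewrite gt_eqF.
have P01 n z : 0 <= P n z <= 1 by exact: annealed_hit_itv.
have P0 n : P n 0%N = eps by exact: annealed_hit0.
have Pstep n z : r * step_avg w (P n) z <= P n.+1 z.+1 + eps * expR (- lam * z.+1%:R) * err z.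
  set A := eps * expR _.
  have A0 : 0 <= A by rewrite mulr_ge0 ?expR_ge0 ?(ltW eps0).
  set L := expR (del / 2 * (z + k0)%:R).
  have psiE : trunc_mean PE F L = (fine (psi (z + k0)%N))%:E by rewrite fineK.
  have psi0 : 0 <= fine (psi (z + k0)%N) by exact: fine_ge0.
  have := annealed_hit_succ_ge iidF w_ge0 w_le1 eps01 mean_r r0 lam_r th01 mean_rth
    kap_Mth subcritical n z (expR_gt0 _) psiE.
  rewrite -/P => /le_trans; apply; rewrite -addrA lerD2l /err mulrDr; apply: lerD.
    have dec j : P n (z + j)%N <= eps * expR (- lam * (z%:R + j%:R)).
      have := annealed_hit_decay iidF w_ge0 w_le1 eps01 mean_r r0 lam_r n 0 (z + j).
      by rewrite addn0 annealed_hit0// natrD mulrC.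
    have := step_avg_le_exp w_ge0 w_le1 (P01 n) (ltW eps0) lam_r dec.
    rewrite natr1 -/A => /(ler_wpM2l psi0) /le_trans; apply.
    by rewrite mulrCA.
  have -> : eps `^ (1 + th) = eps * eps `^ th.
    by rewrite powRD ?gt_eqF ?addr_gt0// powRr1 ?(ltW eps0).
  have H : L `^ th * expR (- (lam + del * th) * z.+1%:R) <= expR (- lam * z.+1%:R) * (K * q ^+ z).
    have dt : 0 <= del * th by rewrite mulr_ge0 ?ltW.
    rewrite /L /K /q -expRM -expRM_natr -!expRD ler_expR natrD -(natr1 z).
    have := mulr_ge0 dt (ler0n R z); lra.
  have e2 : 0 <= eps * eps `^ th by rewrite mulr_ge0 ?powR_ge0 ?(ltW eps0).
  have H' := ler_wpM2l e2 H; apply: (le_trans (le_trans _ H')).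
    by rewrite le_eqVlt; apply/orP; left; apply/eqP; ring.
  by rewrite le_eqVlt /A; apply/orP; left; apply/eqP; ring.
move=> n z.
have := barrier_lower v0 err0 err_noninc err_sum w_ge0 w_le1 lam0 r0 lam_r drift eps0 P01 P0 Pstep n z.
apply: le_trans; rewrite ler_wpM2l ?mulr_ge0 ?expR_ge0 ?(ltW eps0)//.
by rewrite lerDl; case/andP: (barrier_itv v0 err0 err_sum z).
Qed.

End annealed_lower_bound.

(** * The jump law *)

Section jump_law.
Context (R : realType) (mu : probability (measurableTypeR R) R).
Hypothesis mu_lattice : mu (\bigcup_j [set (1 - j%:R : R)]) = 1%E.
Local Notation w := (jump_weight mu).
Let lattice : set (measurableTypeR R) := \bigcup_j [set (1 - j%:R : R)].

Let mlattice : measurable lattice. Proof. exact: bigcupT_measurable. Qed.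

Let triv : trivIset setT (fun j : nat => [set (1 - j%:R : R)]).
Proof.
move=> i j _ _ [x [/= -> ]].
by move=> /= /addrI/oppr_inj/eqP; rewrite eqr_nat => /eqP.
Qed.

Lemma jump_weight_ge0 j : 0 <= w j. Proof. exact: fine_ge0. Qed.

Lemma jump_weightE j : (w j)%:E = mu [set (1 - j%:R : R)].
Proof. by rewrite /jump_weight fineK// fin_num_measure. Qed.

Let null_compl : mu (~` lattice) = 0%E.
Proof.
by rewrite -setTD measureD ?setTI//= ?probability_setT ?mu_lattice ?subee// ltry.
Qed.

Lemma integral_lattice (g : R -> \bar R) :
  measurable_fun (setT : set (measurableTypeR R)) g -> (forall y, 0 <= g y)%E ->
  (\int[mu]_y g y = \sum_(j <oo) (w j)%:E * g (1 - j%:R)%R)%E.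
Proof.
move=> mg g0.
have mC : measurable (~` lattice) by exact: measurableC.
rewrite -(setUv lattice) ge0_integral_setU//; first last.
- by rewrite disj_set2E setICr.
- by rewrite setUv.
rewrite [X in (_ + X)%E](null_set_integral mC _ null_compl) ?adde0; last exact: measurable_funTS.
rewrite ge0_integral_bigcup//; last first.
  exact: measurable_funTS.
apply: eq_eseriesr => j _.
transitivity (\int[mu]_(x in [set (1 - j%:R)%R : R]) cst (g (1 - j%:R)%R) x)%E.
  by apply: eq_integral => y; rewrite inE /= => ->.
by rewrite integral_cst// jump_weightE muleC.
Qed.

Lemma jump_weight_sum : (\sum_(j <oo) (w j)%:E = 1)%E.
Proof.
have := @integral_lattice (cst 1%E) (@measurable_cst _ _ _ _ _ _) (fun=> lee01).
rewrite integral_cst//= mul1e => H.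
rewrite -(probability_setT mu) H.
by apply: eq_eseriesr => j _; rewrite mule1.
Qed.

Definition mgf (lam : R) : \bar R := (\int[mu]_y (expR (lam * y))%:E)%E.

Lemma mgf_series lam : (mgf lam = \sum_(j <oo) (w j * expR (lam * (1 - j%:R)))%:E)%E.
Proof.
rewrite /mgf integral_lattice//.
by apply/measurable_EFinP; apply: (measurableT_comp (@measurable_expR R)); exact: mulrl_measurable.
Qed.

Hypothesis mu_int : mu.-integrable setT (EFin : measurableTypeR R -> \bar R).
Hypothesis mu_mean : (\int[mu]_y y%:E = 0)%E.
Hypothesis mu_nontrivial : forall y : R, mu [set y] != 1%E.

Lemma jump_weight_mean : (\sum_(j <oo) (w j * j%:R)%:E = 1)%E.
Proof.
have mabs : measurable_fun (setT : set (measurableTypeR R)) (fun y : R => `|1 - y|%:E).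
  apply/measurable_EFinP; apply: measurableT_comp => //.
  exact: measurable_funB.
transitivity (\int[mu]_y (`|1 - y|%R%:E))%E.
  rewrite integral_lattice//; apply: eq_eseriesr => j _.
  by rewrite EFinM opprB addrC subrK ger0_norm.
transitivity (\int[mu]_y (1 - y%:E))%E.
  apply: ae_eq_integral => //.
    by apply: emeasurable_funB => //; exact/measurable_EFinP.
  exists (~` lattice); split => //; first exact: measurableC.
  move=> y /= H Hy; apply: H => _; case: Hy => j _ /= ->.
  by rewrite -EFinB ger0_norm// opprB addrC subrK.
rewrite integralB//; last exact: finite_measure_integrable_cst.
rewrite mu_mean sube0 integral_cst// mul1e; exact: (probability_setT mu).
Qed.

(** Otherwise the walk never steps up, and a law on the nonpositive integers
    with mean 0 is the point mass at 0. *)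
Lemma jump_weight0_gt0 : 0 < w 0.
Proof.
rewrite lt_neqAle jump_weight_ge0 andbT; apply/eqP => w0.
have S1 := jump_weight_sum; have S2 := jump_weight_mean.
have e1 : (\sum_(1 <= j <oo) (w j)%:E = 1)%E.
  by rewrite -S1 [RHS]nneseries_recl//= -?w0 ?add0e// => j _; rewrite lee_fin jump_weight_ge0.
have ge j : (0 <= (w j)%:E)%E by rewrite lee_fin jump_weight_ge0.
have ge' j : (0 <= (w j * j%:R)%:E)%E by rewrite lee_fin mulr_ge0 ?jump_weight_ge0.
have e2 : (\sum_(1 <= j <oo) (w j * j%:R)%:E = 1)%E.
  by rewrite -S2 [RHS]nneseries_recl//= mulr0 add0e.
have e3 : (\sum_(1 <= j <oo) (w j)%:E + \sum_(1 <= j <oo) (w j * (j%:R - 1))%:E =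
    \sum_(1 <= j <oo) (w j * j%:R)%:E)%E.
  rewrite -nneseriesD//.
    by apply: eq_eseriesr => j _; rewrite -EFinD; congr EFin; ring.
  by move=> j j1 _; rewrite lee_fin mulr_ge0 ?jump_weight_ge0// subr_ge0 ler1n.
have e4 : (\sum_(1 <= j <oo) (w j * (j%:R - 1))%:E = 0)%E.
  move: e3; rewrite e1 e2 => /eqP; rewrite addeC eq_sym -sube_eq//; last first.
    by rewrite fin_num_adde_defl.
  by rewrite subee// => /eqP.
have w2 j : (2 <= j)%N -> w j = 0.
  move=> j2; apply/eqP; rewrite eq_le jump_weight_ge0 andbT.
  have : ((w j * (j%:R - 1))%:E <= 0)%E.
    have geB i : (1 <= i)%N -> true -> (0 <= (w i * (i%:R - 1))%:E)%E.
      by move=> i1 _; rewrite lee_fin mulr_ge0 ?jump_weight_ge0// subr_ge0 ler1n.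
    rewrite -e4; apply: le_trans (nneseries_lim_ge j.+1 geB).
    rewrite big_nat_recr/= ?(ltnW j2)// leeDr// big_nat; apply: sume_ge0 => i /andP[i1 _].
    exact: geB.
  rewrite lee_fin pmulr_lle0// subr_gt0 ltr1n//.
have mu0 : mu [set (0 : R)] = (w 1)%:E by rewrite jump_weightE subrr.
have := mu_nontrivial 0; rewrite mu0.
move: e1; rewrite (@nneseries_split _ _ 1 1)//.
rewrite addn1 big_nat1 eseries0 ?adde0; last by move=> j j2 _; rewrite w2.
by move=> ->; rewrite eqxx.
Qed.

(** Jensen's inequality for the moment generating function and for its slope,
    made strict by the mass that the jump law must give to 1. *)
Lemma mgf_drift (lam r : R) : 0 < lam -> 0 < r -> mgf lam = (r^-1)%:E ->
  r < 1 /\ exists2 v, 0 < v & (\sum_(j <oo) (w j * expR (lam * (1 - j%:R)) * j%:R)%:E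
    <= ((1 - v) / r)%:E)%E.
Proof.
move=> lam0 r0; rewrite mgf_series => HM.
have wp := jump_weight0_gt0; have wge := jump_weight_ge0.
have at0 : (\sum_(j <oo) (w j * (j == 0)%:R)%:E = (w 0)%:E)%E.
  rewrite (@nneseriesD1 _ _ 0)//; last by move=> j _; rewrite lee_fin mulr_ge0.
  rewrite eqxx mulr1 eseries_cond eseries0 ?adde0// => j _ /andP[/negbTE ->].
  by rewrite mulr0.
(* every pointwise inequality of this shape can be averaged over the jump law,
   whose weights and first moment are known *)
have combine (a b c e : R) : 0 <= a -> 0 <= b -> 0 <= c -> 0 <= e ->
   (forall j : nat, a + b * (j == 0)%:R + c * j%:R * expR (lam * (1 - j%:R)) <=
      expR (lam * (1 - j%:R)) + e * j%:R) ->
   (a%:E + b%:E * (w 0)%:E + c%:E * \sum_(j <oo) (w j * expR (lam * (1 - j%:R)) * j%:R)%:E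
      <= (r^-1)%:E + e%:E)%E.
  move=> a0 b0 c0 e0 H.
  rewrite -at0 -HM -[X in (X + _ + _)%E]mule1 -{1}jump_weight_sum.
  rewrite -[X in (_ <= _ + X)%E]mule1 -jump_weight_mean.
  have q1 j : 0 <= w j * expR (lam * (1 - j%:R)) * j%:R by rewrite !mulr_ge0 ?expR_ge0.
  have q2 j : 0 <= w j * (j == 0)%:R by rewrite mulr_ge0.
  have q3 j : 0 <= w j * j%:R by rewrite mulr_ge0.
  have q4 j : 0 <= w j * expR (lam * (1 - j%:R)) by rewrite mulr_ge0 ?expR_ge0.
  rewrite -!nneseriesZl; do ?by move=> j _; rewrite lee_fin.
  rewrite -nneseriesD; do ?by move=> j _ _; rewrite -EFinM lee_fin mulr_ge0.
  rewrite -nneseriesD; do ?by move=> j _ _; rewrite -?EFinM -?EFinD lee_fin ?addr_ge0 ?mulr_ge0.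
  rewrite -nneseriesD; do ?by move=> j _ _; rewrite -?EFinM lee_fin ?mulr_ge0 ?expR_ge0.
  apply: lee_nneseries => j.
    by move=> _ _; rewrite -!EFinM -!EFinD lee_fin !addr_ge0// mulr_ge0.
  move=> _; rewrite -!EFinM -!EFinD lee_fin.
  by have := ler_wpM2l (wge j) (H j); lra.
have el : lam + 1 < expR lam by rewrite addrC expR_gt1Dx// gt_eqF.
split.
  have := combine (1 + lam) (expR lam - 1 - lam) 0 lam.
  rewrite mul0e adde0 -EFinM -!EFinD lee_fin => H.
  have : 1 + lam + (expR lam - 1 - lam) * w 0 <= r^-1 + lam.
    apply: H => [||//||[|j]]; [by rewrite addr_ge0 ?ltW|lra|by rewrite ltW| |].
      by rewrite eqxx subr0 !mulr1 !mulr0 mul0r; lra.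
    rewrite mulr0 !mul0r !addr0 -[leLHS]addr0.
    have := expR_ge1Dx (lam * (1 - j.+1%:R)); lra.
  have : 0 < (expR lam - 1 - lam) * w 0 by rewrite mulr_gt0//; lra.
  move=> h1 h2; have : 1 < r^-1 by lra.
  by rewrite invf_gt1.
exists (r * ((expR lam - 1) * w 0)); first by rewrite !mulr_gt0//; lra.
have := combine 1 (expR lam - 1) 1 1.
rewrite mul1e => H.
have {H} : (1%:E + (expR lam - 1)%:E * (w 0)%:E +
   \sum_(j <oo) (w j * expR (lam * (1 - j%:R)) * j%:R)%:E <= (r^-1)%:E + 1%:E)%E.
  apply: H => // [|[|j]]; first by lra.
    by rewrite eqxx subr0 !mulr1 !mulr0 mul0r; lra.
  rewrite mulr0 addr0 !mul1r.
  have : expR (lam * (1 - j.+1%:R)) <= 1.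
    by rewrite -[leRHS]expR0 ler_expR mulr_ge0_le0 ?(ltW lam0)// subr_le0 ler1n.
  have : 0 <= j%:R :> R by [].
  rewrite -natr1; nra.
rewrite -EFinM -!EFinD -leeBrDl// -EFinB => /le_trans; apply.
rewrite lee_fin le_eqVlt; apply/orP; left; apply/eqP; field.
by rewrite gt_eqF.
Qed.

End jump_law.

(** * Differentiability of the Laplace exponents *)

Section exponential_moments.
Context d (T : measurableType d) (R : realType) (mu : {measure set T -> \bar R}).
Variables (X : T -> R) (a h : R).
Hypothesis mX : measurable_fun setT X.
Hypothesis h0 : 0 < h.
Hypothesis fin : forall x, a - 2 * h <= x <= a + 2 * h ->
  (\int[mu]_y (expR (x * X y))%:E < +oo)%E.

Let mexp x : measurable_fun setT (fun y => expR (x * X y)).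
Proof. by apply: (measurableT_comp (@measurable_expR R)); exact: measurable_funM. Qed.

Let int_exp x : a - 2 * h <= x <= a + 2 * h ->
  mu.-integrable setT (EFin \o (fun y => expR (x * X y))).
Proof.
move=> xI; apply/integrableP; split; first exact/measurable_EFinP.
apply: le_lt_trans (fin xI); rewrite le_eqVlt; apply/orP; left; apply/eqP.
by apply: eq_integral => y _; rewrite /= ger0_norm// expR_ge0.
Qed.

(** The derivative is dominated near [a] through [|X| <= expR (h * |X|) / h], at
    the price of moving the exponent by [h] once more. *)
Lemma derivable_exponential_moment :
  derivable (fun x : R => \int[mu]_y expR (x * X y)) a 1.
Proof.
pose G y := h^-1 * (expR ((a - 2 * h) * X y) + expR ((a + 2 * h) * X y)).
have sub x : `]a - h, a + h[%classic x -> a - 2 * h <= x <= a + 2 * h.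
  by rewrite /= in_itv/= => /andP[? ?]; apply/andP; split; have := h0; lra.
have dexp (y : T) (x : R) : is_derive x 1 (fun x0 => expR (x0 * X y)) (X y * expR (x * X y)).
  have -> : (fun x0 => expR (x0 * X y)) = expR \o (fun x0 => x0 * X y) by [].
  apply: is_derive_eq.
  by rewrite scaler0 add0r /GRing.scale/= mulr1 mulrC.
refine (@derivable_under_integral R _ T mu (fun x y => expR (x * X y)) setT measurableT a
  (a - h) (a + h) _ _ _ G _ _ _).
- by rewrite /= in_itv/=; apply/andP; split; have := h0; lra.
- by move=> x Ix; exact/int_exp/sub.
- by move=> x y _ _; have [] := dexp y x.
- by move=> y; rewrite mulr_ge0 ?invr_ge0 ?(ltW h0)// addr_ge0 ?expR_ge0.
- rewrite /G /comp; under eq_fun do rewrite EFinM EFinD.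
  apply: integrableZl => //; apply: integrableD => //; apply: int_exp;
    apply/andP; split; have := h0; lra.
- move=> x y xI _; rewrite /partial1of2 derive1E (@derive_val _ _ _ _ _ _ _ (dexp y x)).
  rewrite normrM (ger0_norm (expR_ge0 _)) /G.
  have Xh : `|X y| <= h^-1 * expR (h * `|X y|).
    rewrite ler_pdivlMl//; apply: le_trans (expR_ge1Dx _); lra.
  apply: (le_trans (ler_wpM2r (expR_ge0 _) Xh)); rewrite -mulrA -expRD.
  apply: ler_wpM2l; first by rewrite invr_ge0 ltW.
  have [xa1 xa2] : a - h < x /\ x < a + h by move: xI; rewrite /= in_itv/= => /andP.
  have [X0|X0] := leP 0 (X y).
    rewrite ger0_norm//; apply: le_trans (_ : expR ((a + 2 * h) * X y) <= _).
      by rewrite ler_expR -mulrDl ler_wpM2r//; lra.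
    by rewrite lerDr expR_ge0.
  rewrite ltr0_norm//; apply: le_trans (_ : expR ((a - 2 * h) * X y) <= _).
    by rewrite ler_expR mulrN -mulNr -mulrDl ler_wnM2r ?ltW//; lra.
  by rewrite lerDl expR_ge0.
Qed.


Lemma derivable_log_moment (Lam : R -> \bar R) :
  (\forall x \near a, Lam x = lne (\int[mu]_y (expR (x * X y))%:E)%E) ->
  (0 < \int[mu]_y (expR (a * X y))%:E)%E ->
  derivable (fine \o Lam) a 1.
Proof.
move=> LamE a_gt0.
pose I x := (\int[mu]_y (expR (x * X y))%:E)%E.
have aI : a - 2 * h <= a <= a + 2 * h by apply/andP; split; have := h0; lra.
have I0 x : (0 <= I x)%E by apply: integral_ge0 => y _; rewrite lee_fin expR_ge0.
have Ra : 0 < fine (I a) by rewrite fine_gt0// a_gt0; exact: fin.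
have dI : derivable (fine \o I) a 1 := derivable_exponential_moment.
apply: (@near_eq_derivable _ _ _ (fun x : R => ln ((fine \o I) x))) => //.
  have near1 : \forall x \near a, a - 2 * h <= x <= a + 2 * h.
    have /near_in_itvoo : a \in `]a - 2 * h, a + 2 * h[.
      by rewrite in_itv/=; apply/andP; split; have := h0; lra.
    by apply: filterS => x; rewrite in_itv/= => /andP[/ltW -> /ltW ->].
  near=> x; rewrite /= (near LamE x)//.
  have : I x \is a fin_num by rewrite ge0_fin_numE//; apply: fin; near: x.
  rewrite -/(I x); case: (I x) (I0 x) => [r| |]//= r0 _.
  case: ifP => // rle; have -> : r = 0 by apply/eqP; rewrite eq_le rle -lee_fin.
  by rewrite ln0.
have [] // := @is_derive1_comp _ (@ln R) (fine \o I) a _ _ (is_derive1_ln Ra) (DeriveDef dI erefl).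
Unshelve. all: by end_near. Qed.

End exponential_moments.

(** At [th = 0] the expression to be made nonpositive vanishes, and its
    derivative in [th] is the quantity assumed negative plus [del] times the
    derivative of [g] at [lam].  So [del] is chosen first, and then [th]. *)
Lemma choose_exponents (R : realType) (f g : R -> R) (lam : R) :
  derivable f 1 1 -> derivable g lam 1 -> 0 < lam -> f 1 + g lam = 0 ->
  f^`()%classic 1 + g lam - lam * g^`()%classic lam < 0 ->
  exists del th, [/\ 0 < del, 0 < th <= 1, 0 < lam + del * th - lam * th &
    f (1 + th) + th * g lam + g (lam + del * th - lam * th) <= 0].
Proof.
move=> df dg lam0 fg0; rewrite !derive1E.
set f' := 'D_1 f 1; set g' := 'D_1 g lam => D0.
set D := f' + g lam - lam * g' in D0.
pose del := Num.min (lam / 2) (- D / (2 * (`|g'| + 1))).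
have g1 : 0 < `|g'| + 1 by rewrite ltr_wpDl.
have del0 : 0 < del by rewrite lt_min !divr_gt0 ?oppr_gt0 ?mulr_gt0.
have dell : del < lam.
  by rewrite gt_min; apply/orP; left; have := lam0; lra.
have delg : del * g' < - D.
  apply: le_lt_trans (ler_wpM2l (ltW del0) (ler_norm g')) _.
  apply: (@le_lt_trans _ _ (del * (`|g'| + 1))).
    by rewrite ler_wpM2l ?ltW// ltrDl.
  rewrite -ltr_pdivlMr// gt_min; apply/orP; right.
  rewrite ltr_pdivrMr ?mulr_gt0// mulrCA -mulrA mulVf ?gt_eqF// mulr1.
  by have := D0; lra.
pose h (t : R) := f (1 + t) + t * g lam + g (lam + (del - lam) * t).
have hd : is_derive (0 : R) (1 : R) h (f' + g lam + (del - lam) * g').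
  have d1 : is_derive (0 : R) (1 : R) (f \o (fun t => 1 + t)) (f' * 1).
    apply: is_derive1_comp; last by apply: is_derive_eq; rewrite add0r mulr1.
    by rewrite addr0; exact: DeriveDef.
  have d2 : is_derive (0 : R) (1 : R) (fun t : R => t * g lam) (g lam).
    by apply: is_derive_eq; rewrite ?scaler0 ?add0r /GRing.scale/= ?mulr1.
  have d3 : is_derive (0 : R) (1 : R) (g \o (fun t => lam + (del - lam) * t)) (g' * (del - lam)).
    apply: is_derive1_comp; last first.
      by apply: is_derive_eq; rewrite add0r mul1r /GRing.scale/= mulr1.
    by rewrite mulr0 addr0; exact: DeriveDef.
  have := is_deriveD (is_deriveD d1 d2) d3.
  by rewrite mulr1 [g' * _]mulrC.
have h00 : h 0 = 0 by rewrite /h addr0 mul0r mulr0 !addr0.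
have hneg : f' + g lam + (del - lam) * g' < 0 by move: delg; rewrite /D; lra.
have [e e0 He] : exists2 e : R, 0 < e & forall t, 0 < t -> t < e -> h t < 0.
  have [hdv hval] := hd.
  have : (fun t => t^-1 *: ((h \o shift 0) (t *: 1) - h 0)) @ 0^' -->
      f' + g lam + (del - lam) * g' by rewrite -hval; exact: hdv.
  move=> /cvgr_lt /(_ _ hneg) [e /= e0 He]; exists e => // t t0 te.
  have := He t; rewrite /= sub0r normrN (gtr0_norm t0) => /(_ te).
  rewrite gt_eqF// => /(_ isT); rewrite h00 subr0 addr0 /GRing.scale/= mulr1.
  by rewrite pmulr_rlt0// invr_gt0.
pose th := Num.min 1 (e / 2).
have th0 : 0 < th by rewrite lt_min ltr01 divr_gt0.
have th1 : th <= 1 by rewrite ge_min lexx.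
exists del, th; split => //; first by rewrite th0.
  have := mulr_gt0 del0 th0; have : lam * th <= lam by rewrite ler_piMr// ltW.
  lra.
have -> : lam + del * th - lam * th = lam + (del - lam) * th by ring.
apply/ltW/He => //; rewrite gt_min; apply/orP; right; have := e0; lra.
Qed.

(** * Moments of the offspring means *)

Section truncated_means.
Context (R : realType).

(** The integral of a nonnegative function is a supremum over the simple
    functions below it, hence monotone for arbitrary functions. *)
Lemma le_integral_ge0 d (T : measurableType d) (mu : {measure set T -> \bar R})
    (f g : T -> \bar R) :
  (forall x, 0 <= f x)%E -> (forall x, f x <= g x)%E ->
  (\int[mu]_x f x <= \int[mu]_x g x)%E.
Proof.
move=> f0 fg; have g0 x : (0 <= g x)%E := le_trans (f0 x) (fg x).
rewrite !ge0_integralTE//; apply: le_ereal_sup => _ [h hf <-].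
by exists h => // x; exact: le_trans (hf x) (fg x).
Qed.

Lemma count_below (c l m : R) (n : nat) : 0 < c -> 0 <= l -> 0 <= m ->
  c * \sum_(1 <= z < n) (if z%:R * c < l then m else 0) <= m * l.
Proof.
move=> c0 l0 m0; elim: n => [|[|n] IH].
- by rewrite big_geq// mulr0 mulr_ge0.
- by rewrite big_geq// mulr0 mulr_ge0.
rewrite big_nat_recr//=; case: ifPn => [nl|_]; last by rewrite addr0.
have : \sum_(1 <= z < n.+1) (if z%:R * c < l then m else 0) <= n%:R * m.
  apply: (@le_trans _ _ (\sum_(1 <= z < n.+1) m)).
    by apply: ler_sum => z _; case: ifP.
  by rewrite sumr_const_nat subn1 mulr_natl.
move=> H.
have : c * (\sum_(1 <= z < n.+1) (if z%:R * c < l then m else 0) + m) <= c * (n.+1%:R * m).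
  by rewrite ler_wpM2l ?(ltW c0)// -natr1; lra.
by move=> /le_trans; apply; have := ler_wpM2r m0 (ltW nl); rewrite [l * m]mulrC mulrAC [n.+1%:R * m * c]mulrC.
Qed.

(** At most [log eta / c] of the thresholds [expR (c * z)], [z >= 1], lie below
    [eta]. *)
Lemma truncation_count (G : probability nat R) (c : R) (Lam : R) : 0 < c ->
  ((c * expR (- Lam))%:E * \sum_(1 <= z <oo)
     (if second_factorial_moment G <= (expR (c * z%:R))%:E * (mean G * mean G) then 0 else mean G)
   <= expeR (lne (mean G) - Lam%:E) * log_plus (normalized_second_factorial_moment G))%E.
Proof.
move=> c0.
have H0 : (0 <= expeR (lne (mean G) - Lam%:E) * log_plus (normalized_second_factorial_moment G))%E.
  by rewrite mule_ge0 ?expeR_ge0// /log_plus lne_ge0 le_max lexx orbT.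
move: (mean_ge0 G) H0; case mG : (mean G) => [m| |]// m0 H0; last first.
  rewrite eseries0 ?mule0// => z _ _.
  by rewrite mulyy gt0_muley ?leey// lte_fin expR_gt0.
have [m_eq0|mn0] := eqVneq m 0.
  rewrite eseries0 ?mule0// => z _ _; case: ifP => // _.
  by rewrite m_eq0.
have m_gt0 : 0 < m by rewrite lt_neqAle eq_sym mn0 -lee_fin.
rewrite lne_EFin// -EFinB /expeR expRD lnK// /log_plus.
set eta := normalized_second_factorial_moment G.
have etaE : eta = (((m * m)^-1)%:E * second_factorial_moment G)%E.
  rewrite /eta /normalized_second_factorial_moment mG -EFin_expe inver expf_eq0/= (gt_eqF m_gt0).
  by rewrite expr2.
have L0 : (0 <= lne (maxe eta 1))%E by rewrite lne_ge0 le_max lexx orbT.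
case LE : (lne (maxe eta 1%E)) L0 => [l| |]// l0; last first.
  by rewrite gt0_muley ?leey// lte_fin mulr_gt0 ?expR_gt0.
have eta_le : (eta <= (expR l)%:E)%E.
  have -> : (expR l)%:E = maxe eta 1%E.
    rewrite -[LHS]/(expeR l%:E) -LE; apply/eqP; rewrite lneK_eq.
    by rewrite le_max lee01 orbT.
  by rewrite le_max lexx.
have term z : ((if second_factorial_moment G <= (expR (c * z%:R))%:E * (m%:E * m%:E) then 0 else m%:E)
    <= (if (z%:R * c < l)%R then m else 0%R)%:E)%E.
  case: ifPn => H; first by case: ifP => // _; rewrite lee_fin.
  case: ifPn => //; rewrite -leNgt => lz; exfalso; move/negP: H; apply.
  have : (eta <= (expR (c * z%:R))%:E)%E.
    by apply: le_trans eta_le _; rewrite lee_fin ler_expR mulrC.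
  rewrite etaE => /(lee_wpmul2l (_ : (0 <= (m * m)%:E)%E)).
  rewrite lee_fin mulr_ge0// => /(_ isT).
  by rewrite muleA -EFinM divff ?mulf_neq0// mul1e [X in (_ <= X)%E]muleC EFinM.
apply: (@le_trans _ _ ((c * expR (- Lam))%:E * ((m * l / c)%:E))%E); last first.
  rewrite -!EFinM lee_fin le_eqVlt; apply/orP; left; apply/eqP; field.
  by rewrite gt_eqF.
apply: lee_wpmul2l; first by rewrite lee_fin mulr_ge0 ?expR_ge0 ?ltW.
apply: lime_le; first by apply: is_cvg_nneseries => z _ _; case: ifP.
apply: nearW => n; apply: (@le_trans _ _ (\sum_(1 <= z < n) (if (z%:R * c < l)%R then m else 0%R)%:E)%E).
  by apply: lee_sum => z _; exact: term.
rewrite sumEFin lee_fin ler_pdivlMr// mulrC.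
by apply: count_below; rewrite -?lee_fin.
Qed.

Context d (E : measurableType d) (PE : probability E R) (F : int -> E -> law R).
Hypothesis iidF : iid_environment PE F.

Let mF1 : measurable_fun setT (F 1). Proof. by have [H _ _] := iidF. Qed.

Lemma measurable_trunc (L : R) : measurable_fun setT (fun e =>
  (if second_factorial_moment (F 1 e) <= L%:E * (mean (F 1 e) * mean (F 1 e))
   then 0 else mean (F 1 e))%E).
Proof.
apply: (@measurableT_comp _ _ _ _ _ _ (fun G : law R => if (second_factorial_moment G <=
    L%:E * (mean G * mean G))%E then 0%E else mean G) _ (F 1)) => //.
apply: measurable_fun_ifT => //; last exact: measurable_mean.
apply: measurable_fun_lee; first exact: measurable_second_factorial_moment.
by apply: measurable_funeM; apply: emeasurable_funM; exact: measurable_mean.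
Qed.

Lemma trunc_mean_sum (c Lam r : R) : 0 < c -> (\int[PE]_e mean (F 1 e) = r%:E)%E ->
  (\int[PE]_e (expeR (env_X F 1 e - Lam%:E) * log_plus (env_eta F 1 e)) < +oo)%E ->
  (\sum_(z <oo) trunc_mean PE F (expR (c * z%:R)) < +oo)%E.
Proof.
move=> c0 mr Hlog.
have t0 z e : (0 <= (if second_factorial_moment (F 1 e) <= (expR (c * z%:R))%:E *
    (mean (F 1 e) * mean (F 1 e)) then 0 else mean (F 1 e)))%E.
  by case: ifP => // _; exact: mean_ge0.
have tm0 z : (0 <= trunc_mean PE F (expR (c * z%:R)))%E by exact: integral_ge0.
rewrite nneseries_recl//; apply: lte_add_pinfty.
  apply: (@le_lt_trans _ _ (\int[PE]_e mean (F 1 e))%E); last by rewrite mr ltry.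
  by apply: le_integral_ge0 => // e; case: ifP => // _; exact: mean_ge0.
have k0 : 0 < c * expR (- Lam) by rewrite mulr_gt0 ?expR_gt0.
rewrite -(nneseries_addn _ (tm0 : forall i, _)) /trunc_mean -integral_nneseries//; last first.
  by move=> z; exact: measurable_trunc.
set I := (\int[PE]_e _)%E.
suff : ((c * expR (- Lam))%:E * I < +oo)%E.
  have : (0 <= I)%E by apply: integral_ge0 => e _; apply: nneseries_ge0 => z _ _; exact: t0.
  by case: I => [i| |]// _; rewrite ?ltry// gt0_muley// lte_fin.
apply: le_lt_trans Hlog; rewrite /I -ge0_integralZl_EFin ?(ltW k0)//; first last.
- by apply: measurable_nneseries => // z; exact: measurable_trunc.
- by move=> e _; apply: nneseries_ge0 => z _ _; exact: t0.
apply: le_integral_ge0 => e.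
  by rewrite mule_ge0 ?lee_fin ?(ltW k0)//; apply: nneseries_ge0 => z _ _; exact: t0.
rewrite (@nneseries_addn _ (fun z => if (second_factorial_moment (F 1 e) <= (expR (c * z%:R))%:E *
    (mean (F 1 e) * mean (F 1 e)))%E then 0%E else mean (F 1 e)) 1); last by move=> z; exact: t0.
exact: truncation_count.
Qed.

End truncated_means.

(** * The decay of the maximum *)

Section offspring_exponent.
Context (R : realType) d (E : measurableType d) (PE : probability E R) (F : int -> E -> law R).
Hypothesis iidF : iid_environment PE F.
Hypothesis X_int : PE.-integrable setT (env_X F 1).
Local Open Scope ereal_scope.

Lemma expeR_lne_mean rho (G : probability nat R) : (0 < rho)%R ->
  expeR (rho%:E * lne (mean G)) = poweR (mean G) rho.
Proof.
move=> rho0; move: (mean_ge0 G); case: (mean G) => [m| |]// m0 /=; last first.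
  by rewrite gt0_muley ?lte_fin//= gt_eqF.
case: ifPn => [m_le|]; last by rewrite -ltNge => m_gt0 /=; rewrite /powR gt_eqF// mulrC.
have -> : m = 0%R by apply/eqP; rewrite eq_le m_le -lee_fin.
by rewrite gt0_muleNy ?lte_fin//= powR0 ?gt_eqF.
Qed.

Definition log_mean (e : E) : R := fine (env_X F 1 e).

Lemma measurable_log_mean : measurable_fun setT log_mean.
Proof.
apply: measurableT_comp => //.
by have /integrableP[] := X_int.
Qed.

Lemma Lambda_eE rho : (0 < rho)%R ->
  Lambda_e PE F rho = lne (\int[PE]_e (poweR (mean (F 1 e)) rho)).
Proof.
by move=> rho0; rewrite /Lambda_e; congr lne; apply: eq_integral => e _; exact: expeR_lne_mean.
Qed.

(** The real-valued [log_mean] replaces the extended-real logarithm, from which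
    it differs on a null set only. *)
Lemma integral_mean_power rho : (0 < rho)%R ->
  \int[PE]_e (poweR (mean (F 1 e)) rho) = \int[PE]_e (expR (rho * log_mean e))%:E.
Proof.
move=> rho0; have mF1 : measurable_fun setT (F 1) by have [H _ _] := iidF.
apply: ge0_ae_eq_integral => //.
- apply: (measurableT_comp (measurable_poweR rho)).
  exact: (measurableT_comp (@measurable_mean R)).
- apply/measurable_EFinP; apply: (measurableT_comp (@measurable_expR R)).
  by apply: measurable_funM => //; exact: measurable_log_mean.
- by move=> e _; exact: poweR_ge0.
have := integrable_ae measurableT X_int; apply: filterS => e /= H _.
have {}H := H I; rewrite -(expeR_lne_mean _ rho0) -/(env_X F 1 e) /log_mean.
by rewrite -{1}(fineK H) -EFinM.
Qed.

End offspring_exponent.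

Lemma lattice_of_assumption (R : realType) (mu : probability (measurableTypeR R) R) :
  assumption_ii mu -> mu (\bigcup_j [set (1 - j%:R : R)]) = 1%E.
Proof.
case=> H1 _ H2 _ _; pose Z : set (measurableTypeR R) := range (fun z : int => z%:~R : R).
pose L : set (measurableTypeR R) := \bigcup_j [set (1 - j%:R : R)].
have mL : measurable L by exact: bigcupT_measurable.
have mI : measurable (`[2%R, +oo[%classic : set (measurableTypeR R)) by exact: measurable_itv.
have mZ : measurable Z.
  rewrite (_ : Z = \bigcup_(z in [set: int]) [set (z%:~R : R)]).
    by apply: countable_bigcupT_measurable => //; exact: countableP.
  by apply/seteqP; split => [_ [z _ <-]|_ [z _ ->]]; exists z.
apply/eqP; rewrite eq_le probability_le1//=.
have : (mu Z <= mu (L `|` `[2%R, +oo[%classic))%E; last first.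
  move=> /le_trans /(_ (measureU2 mu mL mI)); rewrite {1}/Z H1.
  by rewrite [X in (_ + X)%E](_ : _ = 0%E) ?adde0.
apply: le_measure; rewrite ?inE//; first exact: measurableU.
move=> _ [z _ <-]; have [z1|z2] := leP z 1; [left|right].
  exists (absz (1 - z)) => //=.
  rewrite natr_absz ger0_norm ?subr_ge0// intrB; ring.
by rewrite /= in_itv/= andbT -[2]/(2%:~R) ler_int.
Qed.

Lemma cvg_nonincreasing_itv (R : realType) (q : nat -> R) (lo hi : R) :
  (forall n, q n.+1 <= q n) -> (forall n, lo <= q n) -> q 0%N <= hi ->
  exists2 l, lo <= l <= hi & q n @[n --> \oo] --> l.
Proof.
move=> qs ql q0.
have ni : nonincreasing_seq q by exact/nonincreasing_seqP.
have lb : has_lbound (range q) by exists lo => _ [n _ <-].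
exists (inf (range q)); last exact: nonincreasing_cvgn.
apply/andP; split; first by apply: lb_le_inf; [exists (q 0%N), 0%N|move=> _ [n _ <-]].
by apply: le_trans q0; apply: ge_inf => //; exists 0%N.
Qed.

Theorem theorem2 (R : realType) (dE dO : measure_display)
    (E : measurableType dE) (PE : probability E R) (F : int -> E -> law R)
    (mu : probability (measurableTypeR R) R)
    (Omega : measurableType dO) (Pxi : R.-pker E ~> Omega)
    (N : seq nat -> {mfun Omega >-> nat})
    (D : seq nat -> {mfun Omega >-> measurableTypeR R})
    (lambda1 : R) :
  iid_environment PE F ->
  (forall e : E, is_quenched_law mu (F ^~ e) (Pxi e) N D) ->
  assumption_i PE F ->
  assumption_ii mu ->
  (1 < alpha PE F)%E ->
  0 < lambda1 ->
  (Lambda_e PE F 1 + Lambda_s mu lambda1 = 0)%E ->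
  ((fine \o Lambda_e PE F)^`())%classic 1 + fine (Lambda_s mu lambda1)
    - lambda1 * ((fine \o Lambda_s mu)^`())%classic lambda1 < 0 ->
  (\int[PE]_e (expeR (env_X F 1 e - Lambda_e PE F 1)
                 * log_plus (env_eta F 1 e)) < +oo)%E ->
  exists C1 : R, 0 < C1 <= 1 /\
    ((expR (lambda1 * x%:R))%:E
       * annealed PE Pxi
           [set w | (x%:R%:E <= maximum (N ^~ w) (D ^~ w))%E])%E
      @[x --> \oo] --> C1%:E.
Proof.
move=> iidF HQ [X_int _ Le_fin] Aii _ lam0 eq1 Theta Hlog.
have mu_lat := lattice_of_assumption Aii.
have [_ mu_nt _ [mu_int mu_mean] [Ls_fin _]] := Aii.
pose w := jump_weight mu.
have w0 : forall j, 0 <= w j := jump_weight_ge0 mu.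
have w1 : (\sum_(j <oo) (w j)%:E <= 1)%E by rewrite (jump_weight_sum mu_lat).
have [le [ls [leE lsE le_ls]]] : exists le ls, [/\ Lambda_e PE F 1 = le%:E,
    Lambda_s mu lambda1 = ls%:E & le + ls = 0].
  move: eq1; case: (Lambda_e PE F 1) => [x| |]; case: (Lambda_s mu lambda1) => [y| |]//.
  by move=> /eqP; rewrite -EFinD eqe => /eqP xy; exists x, y.
have expK (x : \bar R) y : (0 <= x)%E -> lne x = y%:E -> x = (expR y)%:E.
  by move=> x0 xy; rewrite -[RHS]/(expeR y%:E) -xy; apply/esym/eqP; rewrite lneK_eq.
pose r := expR le; have r0 : 0 < r by exact: expR_gt0.
have rV : r^-1 = expR ls by rewrite /r -expRN; congr expR; lra.
have mgf0 x : (0 <= mgf mu x)%E by apply: integral_ge0 => y _; rewrite lee_fin expR_ge0.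
have mgf_lam : mgf mu lambda1 = (r^-1)%:E by rewrite rV; exact: expK.
have lam_r : (\sum_(j <oo) (w j * expR (lambda1 * (1 - j%:R)))%:E = (r^-1)%:E)%E.
  by rewrite -mgf_series.
have pow0 rho : (0 <= \int[PE]_e (poweR (mean (F 1%R e)) rho))%E.
  by apply: integral_ge0 => e _; exact: poweR_ge0.
have pow1 : (\int[PE]_e (poweR (mean (F 1%R e)) 1) = r%:E)%E.
  by apply: expK => //; rewrite -Lambda_eE.
have mean_r : (\int[PE]_e mean (F 1%R e) = r%:E)%E.
  by rewrite -pow1; apply: eq_integral => e _; rewrite poweRe1// mean_ge0.
have [r1 [v v0 drift]] := mgf_drift mu_lat mu_int mu_mean mu_nt lam0 r0 mgf_lam.
have lne_lty (x : \bar R) : (lne x < +oo -> x < +oo)%E by case: x => // x _; exact: ltry.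
have powfin rho : 0 < rho -> (\int[PE]_e (poweR (mean (F 1%R e)) rho) < +oo)%E.
  by move=> rho0; apply: lne_lty; rewrite -Lambda_eE//; apply: Le_fin; exact: ltW.
have mgffin x : 0 < x -> (mgf mu x < +oo)%E by move=> x0; apply: lne_lty; exact: Ls_fin.
have dLe : derivable (fine \o Lambda_e PE F) 1 1.
  (* the window of half-width [2 * 4^-1] around 1 stays inside the positive
     exponents, where the moments are finite *)
  apply: (@derivable_log_moment _ _ _ PE (log_mean F) 1 4^-1).
  - exact: measurable_log_mean X_int.
  - by rewrite invr_gt0.
  - move=> x /andP[x1 _]; have x0 : 0 < x by lra.
    by rewrite -(integral_mean_power iidF X_int)//; exact: powfin.
  - near=> x; have x0 : 0 < x by near: x; exact: lt_nbhsr.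
    by rewrite Lambda_eE// (integral_mean_power iidF X_int).
  - by rewrite -(integral_mean_power iidF X_int)// pow1 lte_fin.
have dLs : derivable (fine \o Lambda_s mu) lambda1 1.
  apply: (@derivable_log_moment _ _ _ mu id lambda1 (lambda1 / 4)).
  - exact: measurable_id.
  - by rewrite divr_gt0.
  - by move=> x /andP[x1 _]; have x0 : 0 < x by [lra|]; exact: mgffin.
  - by near=> x.
  - by rewrite -/(mgf mu lambda1) mgf_lam lte_fin invr_gt0.
have fg0 : (fine \o Lambda_e PE F) 1 + (fine \o Lambda_s mu) lambda1 = 0.
  by rewrite /= leE lsE.
have [del [th [del0 th01 kap0 sub]]] := choose_exponents dLe dLs lam0 fg0 Theta.
have /andP[th0 th1] := th01.
set kap' := lambda1 + del * th - lambda1 * th in kap0 sub.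
have p0 : 0 < 1 + th by rewrite addr_gt0.
pose rth := fine (\int[PE]_e (poweR (mean (F 1%R e)) (1 + th)))%E.
have mean_rth : (\int[PE]_e (poweR (mean (F 1%R e)) (1 + th)) = rth%:E)%E.
  by rewrite /rth fineK// ge0_fin_numE//; exact: powfin.
pose Mth := fine (mgf mu kap').
have mgf_Mth : mgf mu kap' = Mth%:E by rewrite /Mth fineK// ge0_fin_numE//; exact: mgffin.
have kap_Mth : (\sum_(j <oo) (w j * expR (kap' * (1 - j%:R)))%:E = Mth%:E)%E.
  by rewrite -mgf_series.
have subcritical : rth * (r^-1 `^ th) * Mth <= 1.
  have rth0 : 0 <= rth by exact: fine_ge0.
  have Mth0 : 0 <= Mth by exact: fine_ge0.
  have [->|rthn] := eqVneq rth 0; first by rewrite !mul0r.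
  have [->|Mthn] := eqVneq Mth 0; first by rewrite mulr0.
  have rthp : 0 < rth by rewrite lt_neqAle eq_sym rthn.
  have Mthp : 0 < Mth by rewrite lt_neqAle eq_sym Mthn.
  move: sub; rewrite /= Lambda_eE// mean_rth lne_EFin//= lsE/=.
  rewrite -[Lambda_s mu kap']/(lne (mgf mu kap')) mgf_Mth lne_EFin//= => sub.
  rewrite -[X in X * _ * _](lnK rthp) -[X in _ * X](lnK Mthp) rV -expRM -!expRD.
  by rewrite -expR0 ler_expR; lra.
have psi_sum : (\sum_(z <oo) trunc_mean PE F (expR (del / 2 * z%:R)) < +oo)%E.
  apply: (trunc_mean_sum (Lam := le) iidF _ mean_r); first by rewrite divr_gt0.
  by move: Hlog; rewrite leE.
have [eps eps01 lower] := annealed_lower iidF w0 w1 lam0 r0 v0 th01 del0 mean_r lam_r drift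
  mean_rth kap_Mth subcritical psi_sum.
have /andP[eps0 eps1] := eps01.
have o01 : 0 <= (1 : R) <= 1 by rewrite ler01 lexx.
pose a n x := annealed_hit PE F w 1 n x.
pose A (x : nat) := [set om | (x%:R%:E <= maximum (N ^~ om) (D ^~ om))%E].
have PT e : Pxi e setT = 1%E by exact: prob_kernel.
have a01 n x : 0 <= a n x <= 1 by exact: annealed_hit_itv.
have acvg x : cvgn (a ^~ x).
  apply: nondecreasing_is_cvgn; last by exists 1 => _ [n _ <-]; case/andP: (a01 n x).
  by apply/nondecreasing_seqP => n; exact: le_annealed_hit_time.
pose p x := limn (a ^~ x).
have ap x : a n x @[n --> \oo] --> p x by exact: acvg.
have pE x : annealed PE Pxi (A x) = (p x)%:E.
  transitivity (\int[PE]_e limn (fun n => (hit_prob w 1 n (env_from F 0 e) x)%:E))%E.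
    apply: eq_integral => e _; apply/esym/cvg_lim => //.
    exact: (maximum_prob_cvg (PT e) (HQ e) mu_lat (x := x)).
  rewrite monotone_convergence//; first last.
  - move=> e _; apply/nondecreasing_seqP => n; rewrite lee_fin.
    exact: le_hit_prob_time.
  - by move=> n e _; rewrite lee_fin; case/andP: (hit_prob_itv w0 w1 n (env_from F 0 e) x o01).
  - move=> n; apply/measurable_EFinP.
    exact: (measurable_hit_prob_env iidF w0 w1 o01 n x 0).
  rewrite -EFin_lim; last exact: acvg.
  by congr (limn _); apply/funext => n; rewrite /= annealed_hitE.
have decay x : p x.+1 <= expR (- lambda1) * p x.
  have rhs : expR (- lambda1) * a n x @[n --> \oo] --> expR (- lambda1) * p x.
    by apply: cvgM; [exact: cvg_cst|exact: ap].
  apply: (ler_cvg_to (ap x.+1) rhs); apply: nearW => n.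
  have := annealed_hit_decay iidF w0 w1 o01 mean_r r0 lam_r n x 1.
  by rewrite add1n mulr1.
have lowp x : eps / 2 * expR (- lambda1 * x%:R) <= p x.
  have rn : a n x + eps * r ^+ n @[n --> \oo] --> p x + eps * 0.
    apply: cvgD; first exact: ap.
    apply: cvgM; first exact: cvg_cst.
    have := @cvg_geometric R 1 r; rewrite gtr0_norm// => /(_ r1).
    by apply: cvg_trans; apply: near_eq_cvg; apply: nearW => n /=; rewrite mul1r.
  rewrite mulr0 addr0 in rn.
  apply: (ler_cvg_to (cvg_cst _) rn); apply: nearW => n.
  apply: (@le_trans _ _ (annealed_hit PE F w eps n x + eps * r ^+ n)).
    by apply: le_trans (lower n x); lra.
  by rewrite lerD2r; apply: le_annealed_hit_eps => //; rewrite eps1 ltW.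
have [C C01 qC] : exists2 C, eps / 2 <= C <= 1 &
    expR (lambda1 * x%:R) * p x @[x --> \oo] --> C.
  apply: cvg_nonincreasing_itv => [x|x|].
  - apply: le_trans (ler_wpM2l (expR_ge0 _) (decay x)) _.
    rewrite mulrA -expRD -natr1 mulrDr mulr1 addrK; exact: lexx.
  - apply: le_trans (ler_wpM2l (expR_ge0 _) (lowp x)).
    rewrite mulrCA -expRD mulNr addrN expR0 mulr1; exact: lexx.
  - rewrite mulr0 expR0 mul1r.
    rewrite /p (_ : a ^~ 0%N = cst 1) ?lim_cst//.
    by apply/funext => n; rewrite /a annealed_hit0.
exists C; split; first by case/andP: C01 => eC ->; rewrite andbT (lt_le_trans _ eC)// divr_gt0.
under eq_fun do rewrite pE -EFinM.
apply: cvg_EFin => //; exact: nearW.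
Unshelve. all: by end_near. Qed.
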